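(* Let $n=m$, let $\mathbf{B}$ be nonsingular, and assume that the noise assumptions (A1) and (A2) of the context hold with $\sigma_{\mathbf{g}}>0$ and $(\mathbf{x}_0,\mathbf{y}_0)\ne(\mathbf{0},\mathbf{0})$. Fix $\alpha\in(0,1)$, write $\hat\eta=\hat\eta_{\mathbf{M}}(\alpha)$, $\mu=\lambda_{\min}(\mathbf{M})\wedge\lambda_{\min}(\widehat{\mathbf{M}})$, $D_0=\|\mathbf{x}_0\|^2+\|\mathbf{y}_0\|^2$, and let $$E=\left\lceil\frac12\log\left(\frac{\mu}{3\sigma_{\mathbf{g}}^2}D_0\right)\right\rceil .$$ For $i=1,\dots,E$ set $$q_1^{(i)}=\frac{16}{(1-\alpha)\lambda_{\min}(\mathbf{B}\mathbf{B}^\top)}\cdot\frac{e^{2-2i}D_0}{\hat\eta^2},\qquad q_2^{(i)}=\frac{4(\sigma_{\mathbf{B}}^2+\hat\eta^2\sigma_{\mathbf{B},2}^2)\left[e^{2-2i}D_0+\frac{3\sigma_{\mathbf{g}}^2}{\mu}\right]+18\sigma_{\mathbf{g}}^2}{(1-\alpha)\lambda_{\min}(\mathbf{B}\mathbf{B}^\top)},\qquad q_3^{(i)}=\frac{D_0}{e^{2i}},$$ $$K_i=\left\lceil\frac{q_2^{(i)}+\sqrt{(q_2^{(i)})^2+4q_1^{(i)}q_3^{(i)}}}{2q_3^{(i)}}\right\rceil-1 .$$ Run the restarted iteration-averaged SEG method of the context with constant step size $\hat\eta$ and epoch lengths $K_1,\dots,K_E$. Then: (i) for every $j=1,\dots,E$,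 with $K=\sum_{i=1}^{j}K_i$, $$\mathbb{E}\left[\|\hat{\mathbf{x}}_K\|^2+\|\hat{\mathbf{y}}_K\|^2\right]\le e^{-2j}\left[\|\mathbf{x}_0\|^2+\|\mathbf{y}_0\|^2\right];$$ (ii) for every $\hat K=0,1,2,\dots$, with $K=\sum_{i=1}^{E}K_i+\hat K$, the tail averages $\bar{\mathbf{x}}_K,\bar{\mathbf{y}}_K$ satisfy $$\mathbb{E}\left[\|\bar{\mathbf{x}}_K\|^2+\|\bar{\mathbf{y}}_K\|^2\right]\le\frac{16}{(1-\alpha)\lambda_{\min}(\mathbf{B}\mathbf{B}^\top)}\cdot\frac{3\sigma_{\mathbf{g}}^2/\mu}{\hat\eta^2(\hat K+1)^2}+\frac{4(\sigma_{\mathbf{B}}^2+\hat\eta^2\sigma_{\mathbf{B},2}^2)\cdot\frac{6\sigma_{\mathbf{g}}^2}{\mu}+18\sigma_{\mathbf{g}}^2}{(1-\alpha)\lambda_{\min}(\mathbf{B}\mathbf{B}^\top)}\cdot\frac{1}{\hat K+1},$$ and the right-hand side of this bound equals $$\left[1+\frac{\frac{8}{3(\hat K+1)}+R}{\hat\eta^2\mu}\right]\cdot\frac{18\sigma_{\mathbf{g}}^2}{(1-\alpha)\lambda_{\min}(\mathbf{B}\mathbf{B}^\top)}\cdot\frac{1}{\hat K+1}$$ with $|R|\le C(\hat\eta^2\sigma_{\mathbf{B}}^2+\hat\eta^4\sigma_{\mathbf{B},2}^2)$ for an absolute numerical constant $C$.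
   Context: Notation: $a\wedge b=\min(a,b)$, $a\vee b=\max(a,b)$; $\lambda_{\max},\lambda_{\min}$ are the largest and smallest eigenvalues of a real symmetric matrix; $\|\cdot\|$ is the Euclidean norm, $\|\cdot\|_{op}$ the operator norm. Empty sums are $0$. Data: a random triple $(\mathbf{B}_\xi,\mathbf{g}^{\mathbf{x}}_\xi,\mathbf{g}^{\mathbf{y}}_\xi)$ with values in $\mathbb{R}^{n\times m}\times\mathbb{R}^n\times\mathbb{R}^m$; $\mathbb{E}_\xi$ is expectation over it. For $t\ge1$, $(\mathbf{B}_{\xi,t},\mathbf{g}^{\mathbf{x}}_{\xi,t},\mathbf{g}^{\mathbf{y}}_{\xi,t})$ are i.i.d. copies; $(\mathbf{x}_0,\mathbf{y}_0)\in\mathbb{R}^n\times\mathbb{R}^m$ is deterministic. Put $\mathbf{B}=\mathbb{E}_\xi[\mathbf{B}_\xi]$, $\mathbf{M}_\xi=\mathbf{B}_\xi\mathbf{B}_\xi^\top$, $\widehat{\mathbf{M}}_\xi=\mathbf{B}_\xi^\top\mathbf{B}_\xi$, $\mathbf{M}=\mathbb{E}_\xi\mathbf{M}_\xi$, $\widehat{\mathbf{M}}=\mathbb{E}_\xi\widehat{\mathbf{M}}_\xi$. (A1) $\lambda_{\max}(\mathbf{B}^\top\mathbf{B})>0$, $\lambda_{\min}(\mathbf{M})\wedge\lambda_{\min}(\widehat{\mathbf{M}})>0$, and $\sigma_{\mathbf{B}},\sigma_{\mathbf{B},2}\in[0,\infty)$ are such that $\|\mathbb{E}_\xi[(\mathbf{B}_\xi-\mathbf{B})^\top(\mathbf{B}_\xi-\mathbf{B})]\|_{op}\le\sigma_{\mathbf{B}}^2$,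 $\|\mathbb{E}_\xi[(\mathbf{B}_\xi-\mathbf{B})(\mathbf{B}_\xi-\mathbf{B})^\top]\|_{op}\le\sigma_{\mathbf{B}}^2$, $\|\mathbb{E}_\xi[(\widehat{\mathbf{M}}_\xi-\widehat{\mathbf{M}})^2]\|_{op}\le\sigma_{\mathbf{B},2}^2$, $\|\mathbb{E}_\xi[(\mathbf{M}_\xi-\mathbf{M})^2]\|_{op}\le\sigma_{\mathbf{B},2}^2$. (A2) $\sigma_{\mathbf{g}}\in[0,\infty)$ is such that $\mathbb{E}_\xi[\|\mathbf{g}^{\mathbf{x}}_\xi\|^2+\|\mathbf{g}^{\mathbf{y}}_\xi\|^2]\le\sigma_{\mathbf{g}}^2$; $\mathbb{E}_\xi[\mathbf{g}^{\mathbf{x}}_\xi]=\mathbf{0}$, $\mathbb{E}_\xi[\mathbf{g}^{\mathbf{y}}_\xi]=\mathbf{0}$; and $\mathbf{B}_\xi$ is independent of $[\mathbf{g}^{\mathbf{x}}_\xi;\mathbf{g}^{\mathbf{y}}_\xi]$. (SEG step) With step size $\eta$, at time $t\ge1$: $\mathbf{x}_{t-1/2}=\mathbf{x}_{t-1}-\eta[\mathbf{B}_{\xi,t}\mathbf{y}_{t-1}+\mathbf{g}^{\mathbf{x}}_{\xi,t}]$, $\mathbf{y}_{t-1/2}=\mathbf{y}_{t-1}+\eta[\mathbf{B}_{\xi,t}^\top\mathbf{x}_{t-1}+\mathbf{g}^{\mathbf{y}}_{\xi,t}]$, $\mathbf{x}_t=\mathbf{x}_{t-1}-\eta[\mathbf{B}_{\xi,t}\mathbf{y}_{t-1/2}+\mathbf{g}^{\mathbf{x}}_{\xi,t}]$,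 $\mathbf{y}_t=\mathbf{y}_{t-1}+\eta[\mathbf{B}_{\xi,t}^\top\mathbf{x}_{t-1/2}+\mathbf{g}^{\mathbf{y}}_{\xi,t}]$. (Restarted iteration-averaged SEG) Given epoch lengths $K_1,\dots,K_E$, put $T_0=0$, $T_j=\sum_{i=1}^jK_i$. Starting from $(\mathbf{x}_0,\mathbf{y}_0)$, perform SEG steps $t=1,2,\dots$. For $T_{j-1}<t\le T_j$ maintain the running averages over the current epoch $\hat{\mathbf{x}}_t=\frac{1}{t-T_{j-1}}\sum_{s=T_{j-1}+1}^{t}\mathbf{x}_s$ and $\hat{\mathbf{y}}_t=\frac{1}{t-T_{j-1}}\sum_{s=T_{j-1}+1}^{t}\mathbf{y}_s$. At $t=T_j$ ($1\le j\le E$), after computing $\hat{\mathbf{x}}_{T_j},\hat{\mathbf{y}}_{T_j}$, restart: overwrite $\mathbf{x}_{T_j}\leftarrow\hat{\mathbf{x}}_{T_j}$, $\mathbf{y}_{T_j}\leftarrow\hat{\mathbf{y}}_{T_j}$. After time $T_E$ no more restarts occur, and for $K=T_E+\hat K$ the tail averages are $\bar{\mathbf{x}}_K=\frac{1}{\hat K+1}\sum_{s=0}^{\hat K}\mathbf{x}_{T_E+s}$ and $\bar{\mathbf{y}}_K=\frac{1}{\hat K+1}\sum_{s=0}^{\hat K}\mathbf{y}_{T_E+s}$, where $(\mathbf{x}_{T_E},\mathbf{y}_{T_E})$ is the overwritten point. Step size: $\eta_{\mathbf{M}}=1/\sqrt{\rho_1\vee\rho_2}$ with $\rho_1=\lambda_{\max}(\mathbf{M}^{-1/2}[\mathbb{E}_\xi\mathbf{M}_\xi^2]\mathbf{M}^{-1/2})$,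 $\rho_2=\lambda_{\max}(\widehat{\mathbf{M}}^{-1/2}[\mathbb{E}_\xi\widehat{\mathbf{M}}_\xi^2]\widehat{\mathbf{M}}^{-1/2})$, and $$\hat\eta_{\mathbf{M}}(\alpha)=\frac{\eta_{\mathbf{M}}}{\sqrt2}\wedge\frac{\alpha\lambda_{\min}(\mathbf{B}\mathbf{B}^\top)}{2\sigma_{\mathbf{B}}^2\sqrt{\lambda_{\max}(\mathbf{B}^\top\mathbf{B})}},$$ where the second term is read as $+\infty$ if $\sigma_{\mathbf{B}}=0$. *)

(* Defs.v *)
From HB Require Import structures.
From mathcomp Require Import all_boot all_order all_algebra.
From mathcomp Require Import all_classical all_reals all_analysis.

Set Implicit Arguments.
Unset Strict Implicit.
Unset Printing Implicit Defensive.

Import Order.TTheory GRing.Theory Num.Theory.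
Import numFieldNormedType.Exports.

Local Open Scope classical_set_scope.
Local Open Scope ring_scope.

(* MathComp-Analysis equips matrices with the max norm, hence the Euclidean
   and operator norms below. *)

Definition enorm (R : realType) (p : nat) (v : 'cV[R]_p) : R :=
  Num.sqrt (\sum_(i < p) v i 0 ^+ 2).

Definition opnorm (R : realType) (p q : nat) (A : 'M[R]_(p, q)) : R :=
  sup [set enorm (A *m v) | v in [set v : 'cV[R]_q | enorm v <= 1]].

(* For a symmetric real matrix of size p >= 1 the set of eigenvalues is finite
   and nonempty, so the supremum is a maximum and the infimum a minimum.  For
   p = 0 both are 0. *)

Definition lambda_max (R : realType) (p : nat) (A : 'M[R]_p) : R :=
  sup [set a | eigenvalue A a].

Definition lambda_min (R : realType) (p : nat) (A : 'M[R]_p) : R :=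
  inf [set a | eigenvalue A a].

Definition psdmx (R : realType) (p : nat) (A : 'M[R]_p) : Prop :=
  A^T = A /\ forall v : 'cV[R]_p, 0 <= (v^T *m A *m v) 0 0.

(* The unique positive semidefinite square root, when there is one. *)
Definition sqrtmx (R : realType) (p : nat) (A : 'M[R]_p) : 'M[R]_p :=
  xget 0 [set S | psdmx S /\ S *m S = A].

Definition invsqrtmx (R : realType) (p : nat) (A : 'M[R]_p) : 'M[R]_p :=
  invmx (sqrtmx A).

(* The Borel sigma-algebra: <<s G >> is the sigma-algebra generated by G. *)
Definition borel_set (E : topologicalType) (A : set E) : Prop :=
  <<s [set U : set E | open U] >> A.

Definition random_element d (T : measurableType d) (E : topologicalType)
    (X : T -> E) : Prop :=
  forall A : set E, borel_set A -> measurable (X @^-1` A).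

Definition same_law (R : realType) d (S : measurableType d)
    (Q : probability S R) d' (T : measurableType d') (P : probability T R)
    (E : topologicalType) (X : S -> E) (Y : T -> E) : Prop :=
  forall A : set E, borel_set A -> Q (X @^-1` A) = P (Y @^-1` A).

Definition independent2 (R : realType) d (T : measurableType d)
    (P : probability T R) (E F : topologicalType)
    (X : T -> E) (Y : T -> F) : Prop :=
  forall (A : set E) (C : set F), borel_set A -> borel_set C ->
  P ((X @^-1` A) `&` (Y @^-1` C)) = (P (X @^-1` A) * P (Y @^-1` C))%E.

Definition mutually_independent (R : realType) d (T : measurableType d)
    (P : probability T R) (E : topologicalType) (X : nat -> T -> E) : Prop :=
  forall (J : seq nat) (A : nat -> set E), uniq J ->
  (forall t, t \in J -> borel_set (A t)) ->
  P (\bigcap_(t in [set` J]) (X t @^-1` A t)) =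
  (\prod_(t <- J) P (X t @^-1` A t))%E.

Definition iid_copies (R : realType) d (S : measurableType d)
    (Q : probability S R) d' (T : measurableType d') (P : probability T R)
    (E : topologicalType) (X : S -> E) (Xs : nat -> T -> E) : Prop :=
  [/\ forall t, random_element (Xs t),
      forall t, same_law Q P X (Xs t) &
      mutually_independent P Xs].

Definition mx_integrable (R : realType) d (S : measurableType d)
    (Q : probability S R) (p q : nat) (X : S -> 'M[R]_(p, q)) : Prop :=
  forall i j, Q.-integrable [set: S] (fun w => (X w i j)%:E).

(* Meaningful when X is mx_integrable. *)
Definition Emx (R : realType) d (S : measurableType d)
    (Q : probability S R) (p q : nat) (X : S -> 'M[R]_(p, q)) : 'M[R]_(p, q) :=
  \matrix_(i < p, j < q) fine 'E_Q[(fun w => X w i j)].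

(* The values of the triple (B_xi, (gx_xi, gy_xi)). *)
Notation sample R n m := ('M[R]_(n, m) * ('cV[R]_n * 'cV[R]_m))%type.

Definition Bxi (R : realType) (n m : nat) (s : sample R n m) : 'M[R]_(n, m) :=
  s.1.
Definition gxi (R : realType) (n m : nat) (s : sample R n m) :
  'cV[R]_n * 'cV[R]_m := s.2.
Definition gx (R : realType) (n m : nat) (s : sample R n m) : 'cV[R]_n :=
  s.2.1.
Definition gy (R : realType) (n m : nat) (s : sample R n m) : 'cV[R]_m :=
  s.2.2.
Definition Mxi (R : realType) (n m : nat) (s : sample R n m) : 'M[R]_n :=
  Bxi s *m (Bxi s)^T.
Definition Mhxi (R : realType) (n m : nat) (s : sample R n m) : 'M[R]_m :=
  (Bxi s)^T *m Bxi s.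

Definition meanB (R : realType) d (S : measurableType d)
    (Q : probability S R) (n m : nat) (xi : S -> sample R n m) :
    'M[R]_(n, m) := Emx Q (fun w => Bxi (xi w)).
Definition meanM (R : realType) d (S : measurableType d)
    (Q : probability S R) (n m : nat) (xi : S -> sample R n m) : 'M[R]_n :=
  Emx Q (fun w => Mxi (xi w)).
Definition meanMh (R : realType) d (S : measurableType d)
    (Q : probability S R) (n m : nat) (xi : S -> sample R n m) : 'M[R]_m :=
  Emx Q (fun w => Mhxi (xi w)).

(* The first five fields say that the expectations defining B, M, Mh, rho1 and
   rho2 exist; those of the four centred matrices then exist as well. *)
Record assumption_A1 (R : realType) d (S : measurableType d)
    (Q : probability S R) (n m : nat) (xi : S -> sample R n m)
    (sB sB2 : R) : Prop := AssumptionA1 {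
  A1_intB : mx_integrable Q (fun w => Bxi (xi w));
  A1_intM : mx_integrable Q (fun w => Mxi (xi w));
  A1_intMh : mx_integrable Q (fun w => Mhxi (xi w));
  A1_intM2 : mx_integrable Q (fun w => Mxi (xi w) *m Mxi (xi w));
  A1_intMh2 : mx_integrable Q (fun w => Mhxi (xi w) *m Mhxi (xi w));
  A1_B_gt0 : 0 < lambda_max ((meanB Q xi)^T *m meanB Q xi);
  A1_M_gt0 : 0 < Num.min (lambda_min (meanM Q xi)) (lambda_min (meanMh Q xi));
  A1_sB_ge0 : 0 <= sB;
  A1_sB2_ge0 : 0 <= sB2;
  A1_varBl : opnorm (Emx Q (fun w =>
      (Bxi (xi w) - meanB Q xi)^T *m (Bxi (xi w) - meanB Q xi))) <= sB ^+ 2;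
  A1_varBr : opnorm (Emx Q (fun w =>
      (Bxi (xi w) - meanB Q xi) *m (Bxi (xi w) - meanB Q xi)^T)) <= sB ^+ 2;
  A1_varMh : opnorm (Emx Q (fun w =>
      (Mhxi (xi w) - meanMh Q xi) *m (Mhxi (xi w) - meanMh Q xi))) <= sB2 ^+ 2;
  A1_varM : opnorm (Emx Q (fun w =>
      (Mxi (xi w) - meanM Q xi) *m (Mxi (xi w) - meanM Q xi))) <= sB2 ^+ 2
}.

Record assumption_A2 (R : realType) d (S : measurableType d)
    (Q : probability S R) (n m : nat) (xi : S -> sample R n m)
    (sg : R) : Prop := AssumptionA2 {
  A2_sg_ge0 : 0 <= sg;
  A2_var : ('E_Q[(fun w => enorm (gx (xi w)) ^+ 2 + enorm (gy (xi w)) ^+ 2)%R]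
            <= (sg ^+ 2)%:E)%E;
  A2_meanx : Emx Q (fun w => gx (xi w)) = 0;
  A2_meany : Emx Q (fun w => gy (xi w)) = 0;
  A2_indep : independent2 Q (fun w => Bxi (xi w)) (fun w => gxi (xi w))
}.

Definition rho1 (R : realType) d (S : measurableType d)
    (Q : probability S R) (n m : nat) (xi : S -> sample R n m) : R :=
  lambda_max (invsqrtmx (meanM Q xi)
              *m Emx Q (fun w => Mxi (xi w) *m Mxi (xi w))
              *m invsqrtmx (meanM Q xi)).

Definition rho2 (R : realType) d (S : measurableType d)
    (Q : probability S R) (n m : nat) (xi : S -> sample R n m) : R :=
  lambda_max (invsqrtmx (meanMh Q xi)
              *m Emx Q (fun w => Mhxi (xi w) *m Mhxi (xi w))
              *m invsqrtmx (meanMh Q xi)).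

Definition etaM (R : realType) d (S : measurableType d)
    (Q : probability S R) (n m : nat) (xi : S -> sample R n m) : R :=
  1 / Num.sqrt (Num.max (rho1 Q xi) (rho2 Q xi)).

(* The second term of the minimum is +oo when sB = 0. *)
Definition eta_hat (R : realType) d (S : measurableType d)
    (Q : probability S R) (n m : nat) (xi : S -> sample R n m)
    (sB alpha : R) : R :=
  let B := meanB Q xi in
  let a := etaM Q xi / Num.sqrt 2 in
  if sB == 0 then a
  else Num.min a (alpha * lambda_min (B *m B^T)
                  / (2 * sB ^+ 2 * Num.sqrt (lambda_max (B^T *m B)))).

Definition seg_step (R : realType) (n m : nat) (eta : R) (s : sample R n m)
    (z : 'cV[R]_n * 'cV[R]_m) : 'cV[R]_n * 'cV[R]_m :=
  let: (x, y) := z in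
  let xh := x - eta *: (Bxi s *m y + gx s) in
  let yh := y + eta *: ((Bxi s)^T *m x + gy s) in
  (x - eta *: (Bxi s *m yh + gx s), y + eta *: ((Bxi s)^T *m xh + gy s)).

(* State at a time t, before the possible overwriting at time t: the iterate,
   and the sum and number of the iterates of the current epoch. *)
Record run_state (R : realType) (n m : nat) : Type := RunState {
  rs_iter : 'cV[R]_n * 'cV[R]_m;
  rs_sum : 'cV[R]_n * 'cV[R]_m;
  rs_len : nat
}.

Definition rs_avg (R : realType) (n m : nat) (st : run_state R n m) :
    'cV[R]_n * 'cV[R]_m :=
  (rs_len st)%:R^-1 *: rs_sum st.

Definition rs_overwrite (R : realType) (n m : nat) (restart : bool)
    (st : run_state R n m) : run_state R n m :=
  if restart then RunState (rs_avg st) 0 0 else st.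

(* T_j = K_1 + ... + K_j; the value Kl 0 is never used. *)
Definition epoch_end (Kl : nat -> nat) (j : nat) : nat :=
  (\sum_(1 <= i < j.+1) Kl i)%N.

Definition is_restart (E : nat) (Kl : nat -> nat) (t : nat) : bool :=
  has (fun j => t == epoch_end Kl j) (iota 1 E).

(* s t is the sample used by the step at time t.+1. *)
Fixpoint seg_run (R : realType) (n m : nat) (eta : R) (E : nat)
    (Kl : nat -> nat) (z0 : 'cV[R]_n * 'cV[R]_m) (s : nat -> sample R n m)
    (t : nat) : run_state R n m :=
  if t is t'.+1 then
    let st := rs_overwrite (is_restart E Kl t') (seg_run eta E Kl z0 s t') in
    let z := seg_step eta (s t') (rs_iter st) in
    RunState z (rs_sum st + z) (rs_len st).+1
  else RunState z0 0 0.

(* (x_t, y_t), after the overwriting if t is a restart time. *)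
Definition seg_iter (R : realType) (n m : nat) (eta : R) (E : nat)
    (Kl : nat -> nat) (z0 : 'cV[R]_n * 'cV[R]_m) (s : nat -> sample R n m)
    (t : nat) : 'cV[R]_n * 'cV[R]_m :=
  rs_iter (rs_overwrite (is_restart E Kl t) (seg_run eta E Kl z0 s t)).

(* The running average over the current epoch. *)
Definition seg_hat (R : realType) (n m : nat) (eta : R) (E : nat)
    (Kl : nat -> nat) (z0 : 'cV[R]_n * 'cV[R]_m) (s : nat -> sample R n m)
    (t : nat) : 'cV[R]_n * 'cV[R]_m :=
  rs_avg (seg_run eta E Kl z0 s t).

(* The tail average at time T_E + Kh. *)
Definition seg_tail (R : realType) (n m : nat) (eta : R) (E : nat)
    (Kl : nat -> nat) (z0 : 'cV[R]_n * 'cV[R]_m) (s : nat -> sample R n m)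
    (Kh : nat) : 'cV[R]_n * 'cV[R]_m :=
  (Kh.+1)%:R^-1 *: \sum_(0 <= r < Kh.+1)
                      seg_iter eta E Kl z0 s (epoch_end Kl E + r).

(* Main.v *)
From HB Require Import structures.
Require Import Defs.
From mathcomp Require Import all_boot all_order all_algebra.
From mathcomp Require Import all_classical all_reals all_analysis.
From mathcomp Require Import measurable_realfun.
From mathcomp Require Import ring lra.

Set Implicit Arguments.
Unset Strict Implicit.
Unset Printing Implicit Defensive.

Import Order.TTheory GRing.Theory Num.Theory.
Import numFieldNormedType.Exports.

Local Open Scope classical_set_scope.
Local Open Scope ring_scope.

(** Why the theorem holds.  Stack the two players into one state [z = (x, y)].
A stochastic extragradient step is an affine random map [z |-> A z + b], where
[A = I - eta J + eta^2 J^2] for the skew matrix [J] of the sampled coupling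
and where [b] is linear in the centred noise [g], which is independent of [J].

Energy.  Since [J] is skew, the odd powers of [eta] cancel in [|A z|^2]
([sqn_det_step]).  The step size makes the fourth moments of the coupling cost
at most half of what the second moments gain, and the cross term with [g]
vanishes by independence ([integral_add_seg_noise]).  With
[a = eta^2 mu / 2] one obtains
[E |z_t|^2 <= (1 - a) E |z_(t-1)|^2 + a (3 sg^2 / mu)] ([seg_step_energy]):
every level [D >= 3 sg^2 / mu] is preserved ([block_energy]).

Averages.  Let [mean] be the expected linear part of the step.  Summing
[z_(i+1) = mean z_i + deviation_i] over a block of [N] iterates gives
[(I - mean) (sum of the z_i) = z_0 - z_N + (sum of the deviations)].  The
deviations are uncorrelated, so that their sum has energy of order [N], while
[I - mean] expands norms by at least
[eta * sqrt ((1 - alpha) lambda_min (B B^T))] ([mean_step_coercive]).  The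
average over the block is therefore [O (1 / N^2) + O (1 / N)] in mean square
([block_sum], [window_average]).

Restarts.  At the beginning of epoch [j + 1] take
[D = e^(- 2 j) D0], which is at least [3 sg^2 / mu] by the choice of the number of
epochs.  The length of the epoch makes the bound on the average at most
[e^(- 2) D].  The running average omits the point at which the epoch starts,
whereas the formula for the length counts it; the constants of the formula
absorb this because every epoch has at least nine steps ([epoch_arith]).  After
the last epoch the same block estimate with [D = 3 sg^2 / mu] bounds the tail
average.

All expectations of random steps are computed by Tonelli's theorem for
independent variables: the past of the run is frozen and the next sample is
averaged ([past_freeze]), so that no integrability of the iterates has to be
established. *)

(** * Euclidean vectors and the operator norm *)

Definition dotv (R : realType) (p : nat) (u v : 'cV[R]_p) : R :=
  \sum_i u i 0 * v i 0.

Section dotv.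
Context {R : realType}.

Lemma dotv_mx p (u v : 'cV[R]_p) : (u^T *m v) 0 0 = dotv u v.
Proof. by rewrite mxE; apply: eq_bigr => i _; rewrite mxE. Qed.

Lemma dotvC p (u v : 'cV[R]_p) : dotv u v = dotv v u.
Proof. by apply: eq_bigr => i _; rewrite mulrC. Qed.

Lemma dotvDl p (u v w : 'cV[R]_p) : dotv (u + v) w = dotv u w + dotv v w.
Proof. by rewrite -big_split; apply: eq_bigr => i _; rewrite mxE mulrDl. Qed.

Lemma dotvZl p a (u v : 'cV[R]_p) : dotv (a *: u) v = a * dotv u v.
Proof. by rewrite mulr_sumr; apply: eq_bigr => i _; rewrite mxE mulrA. Qed.

Lemma dotvNl p (u v : 'cV[R]_p) : dotv (- u) v = - dotv u v.
Proof. by rewrite -scaleN1r dotvZl mulN1r. Qed.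

Lemma dotvBl p (u v w : 'cV[R]_p) : dotv (u - v) w = dotv u w - dotv v w.
Proof. by rewrite dotvDl dotvNl. Qed.

Lemma dotvDr p (u v w : 'cV[R]_p) : dotv u (v + w) = dotv u v + dotv u w.
Proof. by rewrite dotvC dotvDl !(dotvC u). Qed.

Lemma dotvZr p a (u v : 'cV[R]_p) : dotv u (a *: v) = a * dotv u v.
Proof. by rewrite dotvC dotvZl dotvC. Qed.

Lemma dotvNr p (u v : 'cV[R]_p) : dotv u (- v) = - dotv u v.
Proof. by rewrite dotvC dotvNl dotvC. Qed.

Lemma dotvBr p (u v w : 'cV[R]_p) : dotv u (v - w) = dotv u v - dotv u w.
Proof. by rewrite dotvDr dotvNr. Qed.

Lemma dot0v p (v : 'cV[R]_p) : dotv 0 v = 0.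
Proof. by rewrite -(scale0r 0) dotvZl mul0r. Qed.

Lemma dotv_mull p q (A : 'M[R]_(p, q)) u v :
  dotv (A *m u) v = dotv u (A^T *m v).
Proof. by rewrite -!dotv_mx trmx_mul mulmxA. Qed.

Lemma dotv_mulr p q (A : 'M[R]_(p, q)) u v :
  dotv u (A *m v) = dotv (A^T *m u) v.
Proof. by rewrite dotv_mull trmxK. Qed.

Lemma dotv_ge0 p (v : 'cV[R]_p) : 0 <= dotv v v.
Proof. by apply: sumr_ge0 => i _; rewrite -expr2 sqr_ge0. Qed.

Lemma dotv_eq0 p (v : 'cV[R]_p) : (dotv v v == 0) = (v == 0).
Proof.
apply/eqP/eqP => [|->]; last by rewrite dot0v.
move=> /eqP; rewrite psumr_eq0; last by move=> i _; rewrite -expr2 sqr_ge0.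
move=> /allP v0; apply/matrixP => i j; rewrite ord1 mxE.
by move: (v0 i (mem_index_enum i)); rewrite mulf_eq0 orbb => /eqP.
Qed.

Lemma dotv_gt0 p (v : 'cV[R]_p) : (0 < dotv v v) = (v != 0).
Proof. by rewrite lt_def dotv_ge0 dotv_eq0 andbT. Qed.

Lemma enorm_ge0 p (v : 'cV[R]_p) : 0 <= enorm v.
Proof. exact: sqrtr_ge0. Qed.

Lemma enorm_dotv p (v : 'cV[R]_p) : enorm v = Num.sqrt (dotv v v).
Proof. by congr Num.sqrt; apply: eq_bigr => i _; rewrite expr2. Qed.

Lemma sqr_enorm p (v : 'cV[R]_p) : enorm v ^+ 2 = dotv v v.
Proof. by rewrite enorm_dotv sqr_sqrtr // dotv_ge0. Qed.

Lemma enorm_eq0 p (v : 'cV[R]_p) : (enorm v == 0) = (v == 0).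
Proof. by rewrite -dotv_eq0 -sqr_enorm sqrf_eq0. Qed.

Lemma enormZ p a (v : 'cV[R]_p) : enorm (a *: v) = `|a| * enorm v.
Proof.
by rewrite !enorm_dotv dotvZl dotvZr mulrA -expr2 sqrtrM ?sqr_ge0 ?sqrtr_sqr.
Qed.

(** Expanding the square of [dotv v v *: u - dotv u v *: v]. *)
Lemma CauchySchwarz p (u v : 'cV[R]_p) :
  dotv u v ^+ 2 <= dotv u u * dotv v v.
Proof.
have [->|v0] := eqVneq v 0.
  by rewrite dotvC !dot0v expr0n /= mulr0.
have := dotv_ge0 (dotv v v *: u - dotv u v *: v).
rewrite dotvBl !dotvBr !dotvZl !dotvZr (dotvC v u).
rewrite -[X in 0 <= X](_ : dotv v v * (dotv u u * dotv v v - dotv u v ^+ 2) = _);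
  last by ring.
by rewrite pmulr_rge0 ?dotv_gt0 // subr_ge0.
Qed.

Lemma ler_dotv_enorm p (u v : 'cV[R]_p) : `|dotv u v| <= enorm u * enorm v.
Proof.
rewrite !enorm_dotv -sqrtrM ?dotv_ge0 // -sqrtr_sqr ler_sqrt ?CauchySchwarz //.
by rewrite mulr_ge0 ?dotv_ge0.
Qed.

(** The supremum that defines the operator norm is finite: each coordinate of
[A *m v] is an inner product with a row of [A]. *)
Lemma enorm_mul_bounded p q (A : 'M[R]_(p, q)) :
  exists C, forall v, enorm v <= 1 -> enorm (A *m v) <= C.
Proof.
exists (Num.sqrt (\sum_i dotv (row i A)^T (row i A)^T)) => v v1.
rewrite ler_sqrt; last by apply: sumr_ge0 => i _; exact: dotv_ge0.
apply: ler_sum => i _.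
rewrite (_ : (A *m v) i 0 = dotv (row i A)^T v); last first.
  by rewrite mxE; apply: eq_bigr => j _; rewrite !mxE.
apply: le_trans (CauchySchwarz _ _) _.
rewrite -[leRHS]mulr1 ler_wpM2l ?dotv_ge0 // -sqr_enorm.
by rewrite -[leRHS](expr1n _ 2) lerXn2r ?nnegrE ?enorm_ge0.
Qed.

Lemma enorm_mul_le p q (A : 'M[R]_(p, q)) v :
  enorm (A *m v) <= opnorm A * enorm v.
Proof.
have [->|v0] := eqVneq v 0.
  have e0 m : enorm (0 : 'cV[R]_m) = 0 by apply/eqP; rewrite enorm_eq0.
  by rewrite mulmx0 !e0 mulr0.
have ev : 0 < enorm v by rewrite lt_def enorm_eq0 v0 enorm_ge0.
rewrite -ler_pdivrMr // mulrC.
rewrite -[(enorm v)^-1]gtr0_norm ?invr_gt0 // -enormZ scalemxAr.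
apply: ub_le_sup.
  have [C AC] := enorm_mul_bounded A.
  by exists C => _ [w w1 <-]; exact: AC.
exists ((enorm v)^-1 *: v) => //=.
by rewrite enormZ gtr0_norm ?invr_gt0 // mulVf // gt_eqF.
Qed.

Lemma dotv_opnorm_le p (A : 'M[R]_p) s v :
  opnorm A <= s -> dotv v (A *m v) <= s * dotv v v.
Proof.
move=> As; apply: le_trans (ler_norm _) _.
apply: le_trans (ler_dotv_enorm _ _) _.
rewrite -sqr_enorm expr2 mulrCA ler_wpM2l ?enorm_ge0 //.
by apply: le_trans (enorm_mul_le _ _) _; rewrite ler_wpM2r ?enorm_ge0.
Qed.

End dotv.

(** * Extreme eigenvalues and square roots of symmetric matrices *)

Section rayleigh.
Context {R : realType}.

Lemma continuous_sum (T : topologicalType) I (r : seq I) (F : I -> T -> R) :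
  (forall i, continuous (F i)) -> continuous (fun x => \sum_(i <- r) F i x).
Proof.
move=> cF; elim: r => [|i r IH].
  by under eq_fun do rewrite big_nil; exact: cst_continuous.
under eq_fun do rewrite big_cons.
by move=> x; apply: (@continuousD _ R^o); [exact: cF | exact: IH].
Qed.

Lemma continuous_quadratic p (M : 'M[R]_p) :
  continuous (fun w : 'rV[R]_p => dotv w^T (M *m w^T)).
Proof.
apply: continuous_sum => i x; apply: (@continuousM R _).
  rewrite (_ : (fun w => _) = fun w : 'rV[R]_p => w 0 i).
    exact: coord_continuous.
  by apply/funext => w; rewrite mxE.
rewrite (_ : (fun w => _) = fun w : 'rV[R]_p => \sum_j M i j * w 0 j).
  apply: continuous_sum => j y; apply: (@continuousM R _).
    exact: cst_continuous.
  exact: coord_continuous.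
by apply/funext => w; rewrite mxE; apply: eq_bigr => j _; rewrite mxE.
Qed.

Lemma dotv_homog_le p (M : 'M[R]_p) a :
  (forall u, dotv u u = 1 -> a <= dotv u (M *m u)) ->
  forall u, a * dotv u u <= dotv u (M *m u).
Proof.
move=> aM u; have [->|u0] := eqVneq u 0.
  by rewrite mulmx0 dot0v mulr0.
have du : 0 < dotv u u by rewrite dotv_gt0.
have eu : 0 < enorm u by rewrite lt_def enorm_eq0 u0 enorm_ge0.
rewrite -sqr_enorm -ler_pdivlMr ?exprn_gt0 //.
have -> : dotv u (M *m u) / enorm u ^+ 2 =
    dotv ((enorm u)^-1 *: u) (M *m ((enorm u)^-1 *: u)).
  by rewrite -scalemxAr dotvZl dotvZr; field; rewrite gt_eqF.
by apply: aM; rewrite dotvZl dotvZr -sqr_enorm; field; rewrite gt_eqF.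
Qed.

(** The quadratic form of [M] attains its minimum [a] on the unit sphere.  At a
minimiser [v] the form [M - a] is nonnegative and vanishes, so that its
first variation along every direction vanishes. *)
Lemma rayleigh_min p (M : 'M[R]_p.+1) : M^T = M ->
  exists a (v : 'cV[R]_p.+1), [/\ dotv v v = 1, M *m v = a *: v &
    forall u, a * dotv u u <= dotv u (M *m u)].
Proof.
move=> symM.
pose S := [set w : 'rV[R]_p.+1 | dotv w^T w^T = 1].
have S0 : S !=set0.
  exists (delta_mx 0 0); rewrite /S /= /dotv (bigD1 0) //= !mxE eqxx mulr1.
  by rewrite big1 ?addr0 // => i /negPf i0; rewrite !mxE i0 mul0r.
have cS : compact S.
  apply: bounded_closed_compact.
    exists 1; split; first exact: num_real.
    move=> x x1 w Sw; apply: le_trans (ltW x1).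
    rewrite [leLHS]mx_normrE; apply/bigmax_leP; split => //= i _.
    rewrite -(expr_le1 (n := 2)) // real_normK ?num_real //.
    rewrite -(Sw : _ = 1) /dotv (bigD1 i.2) //= !mxE (ord1 i.1) -expr2 lerDl.
    by apply: sumr_ge0 => j _; rewrite -expr2 sqr_ge0.
  rewrite (_ : S = (fun w : 'rV[R]_p.+1 => dotv w^T (1%:M *m w^T)) @^-1` [set 1]).
    apply: preimage_closed; last exact: closed_eq.
    by move=> x _; exact: continuous_quadratic.
  by rewrite /S; apply/seteqP; split => w /=; rewrite mul1mx.
have [c cA cmin] := EVT_min_rV S0 cS
  (continuous_subspaceT (@continuous_quadratic _ M)).
pose v := c^T; pose a := dotv v (M *m v).
have v1 : dotv v v = 1 by move: cA; rewrite inE.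
have min u : a * dotv u u <= dotv u (M *m u).
  apply: dotv_homog_le => {}u u1.
  by have := cmin u^T; rewrite inE /S /= trmxK; exact.
exists a, v; split => //.
have ort u : dotv u (M *m v - a *: v) = 0.
  pose b := dotv u (M *m v - a *: v).
  pose g := dotv u (M *m u) - a * dotv u u.
  have g0 : 0 <= g by rewrite subr_ge0.
  have q t : 0 <= 2 * t * b + t ^+ 2 * g.
    have := min (v + t *: u); rewrite -subr_ge0.
    rewrite mulmxDr -scalemxAr !dotvDl !dotvDr !dotvZl !dotvZr.
    rewrite (dotvC v (M *m u)) (dotv_mull M u v) symM (dotvC v u) v1 -/a.
    rewrite /b /g dotvBr dotvZr => h; lra.
  apply/eqP; apply/negP => /negP b0.
  have gp : 0 < g + 1 by lra.
  have := q (- b / (g + 1)).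
  rewrite (_ : _ + _ = - (b / (g + 1)) ^+ 2 * (g + 2)); last by field; rewrite gt_eqF.
  rewrite leNgt mulNr oppr_lt0 mulr_gt0 //; last by lra.
  by rewrite lt_def sqr_ge0 sqrf_eq0 mulf_neq0 // invr_eq0 (gt_eqF gp).
apply/eqP; rewrite -subr_eq0 -dotv_eq0; exact/eqP/ort.
Qed.

Lemma eigenvalue_symP p (M : 'M[R]_p) a : M^T = M ->
  reflect (exists2 v : 'cV[R]_p, M *m v = a *: v & v != 0) (eigenvalue M a).
Proof.
move=> symM; apply: (iffP eigenvalueP) => -[v Mv v0].
  by exists v^T; rewrite ?trmx_eq0 // -{1}symM -trmx_mul Mv linearZ.
by exists v^T; rewrite ?trmx_eq0 // -{1}symM -trmx_mul Mv linearZ.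
Qed.

Lemma lambda_minP p (M : 'M[R]_p.+1) : M^T = M ->
  eigenvalue M (lambda_min M) /\
  forall u, lambda_min M * dotv u u <= dotv u (M *m u).
Proof.
move=> symM; have [a [v [v1 Mv min]]] := rayleigh_min symM.
suff -> : lambda_min M = a.
  split => //; apply/eigenvalue_symP => //; exists v => //.
  by rewrite -dotv_eq0 v1 oner_eq0.
apply/eqP; rewrite eq_le; apply/andP; split.
  apply: ge_inf; last first.
    by apply/eigenvalue_symP => //; exists v; rewrite // -dotv_eq0 v1 oner_eq0.
  exists a => b /(eigenvalue_symP _ symM)[u Mu u0].
  by have := min u; rewrite Mu dotvZr ler_pM2r // dotv_gt0.
apply: lb_le_inf.
  by exists a; apply/eigenvalue_symP => //; exists v;
    rewrite // -dotv_eq0 v1 oner_eq0.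
move=> b /(eigenvalue_symP _ symM)[u Mu u0].
by have := min u; rewrite Mu dotvZr ler_pM2r // dotv_gt0.
Qed.

(** Reduces statements on the largest eigenvalue to the smallest one. *)
Lemma lambda_maxN p (M : 'M[R]_p) : lambda_max M = - lambda_min (- M).
Proof.
rewrite /lambda_max /lambda_min /inf opprK; congr sup.
have opp (a : R) : eigenvalue (- M) (- a) = eigenvalue M a.
  by apply/eigenvalueP/eigenvalueP => -[v Mv v0]; exists v => //;
    move: Mv; rewrite mulmxN scaleNr; [move/oppr_inj | move->].
apply/seteqP; split => a /=.
  by exists (- a); rewrite ?opprK //= opp.
by move=> [b /= Mb <-]; rewrite -opp opprK.
Qed.

Lemma lambda_min_le p (M : 'M[R]_p) u : M^T = M ->
  lambda_min M * dotv u u <= dotv u (M *m u).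
Proof.
case: p => [|p] in M u *; last by move=> /lambda_minP[].
by move=> _; rewrite /dotv !big_ord0 mulr0.
Qed.

Lemma lambda_max_ge p (M : 'M[R]_p) u : M^T = M ->
  dotv u (M *m u) <= lambda_max M * dotv u u.
Proof.
move=> symM; rewrite lambda_maxN mulNr lerNr -dotvNr -mulNmx.
by apply: lambda_min_le; rewrite linearN /= symM.
Qed.

Lemma lambda_min_gt0 p (M : 'M[R]_p.+1) : M^T = M ->
  (forall u, u != 0 -> 0 < dotv u (M *m u)) -> 0 < lambda_min M.
Proof.
move=> symM pos; have [+ _] := lambda_minP symM.
move=> /(eigenvalue_symP _ symM)[v Mv v0].
by have := pos v v0; rewrite Mv dotvZr pmulr_lgt0 ?dotv_gt0.
Qed.

(** For an invertible square [B], the matrices [B^T *m B] and [B *m B^T] are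
similar. *)
Lemma eigenvalue_mulmx_tr p (B : 'M[R]_p) a : B \in unitmx ->
  eigenvalue (B^T *m B) a = eigenvalue (B *m B^T) a.
Proof.
move=> uB; have uBt : B^T \in unitmx by rewrite unitmx_tr.
apply/eigenvalueP/eigenvalueP => -[v Mv v0].
  exists (v *m B^T); first by rewrite -mulmxA [B^T *m _]mulmxA mulmxA Mv scalemxAl.
  apply: contra_neq v0 => v0; have := congr1 (mulmx^~ (invmx B^T)) v0.
  by rewrite /= mul0mx mulmxK.
exists (v *m B); first by rewrite -mulmxA [B *m _]mulmxA mulmxA Mv scalemxAl.
apply: contra_neq v0 => v0; have := congr1 (mulmx^~ (invmx B)) v0.
by rewrite /= mul0mx mulmxK.
Qed.

End rayleigh.

Section psd_square_root.
Context {R : realType}.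

Lemma psdmxP p (A : 'M[R]_p) :
  psdmx A <-> A^T = A /\ forall v, 0 <= dotv v (A *m v).
Proof. by split=> -[symA pos]; split => // v; have := pos v; rewrite -dotv_mx mulmxA. Qed.

Lemma dotv_col p q (u1 v1 : 'cV[R]_p) (u2 v2 : 'cV[R]_q) :
  dotv (col_mx u1 u2) (col_mx v1 v2) = dotv u1 v1 + dotv u2 v2.
Proof. by rewrite -!dotv_mx tr_col_mx mul_row_col mxE. Qed.

(** The reflection along [v - e]. *)
Lemma householder p (v e : 'cV[R]_p) : dotv v v = 1 -> dotv e e = 1 ->
  exists H : 'M[R]_p, [/\ H^T = H, H *m H = 1%:M & H *m v = e].
Proof.
move=> v1 e1; have [->|ve] := eqVneq v e.
  by exists 1%:M; rewrite trmx1 !mul1mx.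
pose u := v - e; pose c := 2 / dotv u u.
have uu : dotv u u != 0 by rewrite dotv_eq0 subr_eq0.
have Euu : dotv u u = 2 * dotv u v.
  by rewrite /u !(dotvBl, dotvBr) v1 e1 (dotvC v e); ring.
have uTu w : u *m (u^T *m w) = dotv u w *: u.
  by rewrite [u^T *m w]mx11_scalar dotv_mx mul_mx_scalar.
have H2 : (1%:M - c *: (u *m u^T)) *m (1%:M - c *: (u *m u^T)) = 1%:M.
  have UU : u *m u^T *m (u *m u^T) = dotv u u *: (u *m u^T).
    by rewrite mulmxA -[u *m u^T *m u]mulmxA uTu scalemxAl.
  have cc : c * c * dotv u u = 2 * c by rewrite /c; field.
  rewrite mulmxBl mul1mx mulmxBr mulmx1 -scalemxAl -scalemxAr UU !scalerA.
  rewrite cc; apply/matrixP => i j; rewrite !mxE; ring.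
exists (1%:M - c *: (u *m u^T)); split => //.
  by rewrite linearB /= trmx1 linearZ /= trmx_mul trmxK.
rewrite mulmxBl mul1mx -scalemxAl -mulmxA uTu scalerA.
rewrite (_ : c * dotv u v = 1) ?scale1r ?subKr //.
by rewrite /c Euu; field; move: uu; rewrite Euu mulf_eq0 pnatr_eq0.
Qed.

(** Induction on the size: a reflection that moves a unit eigenvector to the
first basis vector makes the matrix block diagonal. *)
Lemma psd_sqrt_exists p (M : 'M[R]_p) : psdmx M ->
  exists S, psdmx S /\ S *m S = M.
Proof.
elim: p => [|p IH] in M *.
  move=> psdM; exists 0; split; last by rewrite [LHS]flatmx0 [RHS]flatmx0.
  apply/psdmxP; split; first by rewrite linear0.
  by move=> v; rewrite mul0mx dotvC dot0v.
move=> /psdmxP[symM posM].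
have [a [v [v1 Mv _]]] := rayleigh_min symM.
have a0 : 0 <= a by have := posM v; rewrite Mv dotvZr v1 mulr1.
pose e : 'cV[R]_(1 + p) := col_mx 1%:M 0.
have e1 : dotv e e = 1.
  by rewrite dotv_col -!dotv_mx trmx1 mul1mx mulmx0 !mxE eqxx addr0.
have [H [symH HH Hv]] := householder v1 e1.
pose N : 'M[R]_(1 + p) := H *m (M : 'M[R]_(1 + p)) *m H.
have symN : N^T = N by rewrite /N !trmx_mul symH symM mulmxA.
have He : H *m e = v by rewrite -Hv mulmxA HH mul1mx.
have Ne : N *m e = a *: e.
  by rewrite /N -!mulmxA He Mv -scalemxAr Hv.
have Nl : ulsubmx N = a%:M /\ dlsubmx N = 0.
  move: Ne; rewrite -[N]submxK /e mul_block_col !mulmx0 !mulmx1 !addr0.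
  rewrite scale_col_mx scaler0 scale_scalar_mx mulr1 => /eq_col_mx[-> ->].
  by rewrite block_mxKul block_mxKdl.
have Nur : ursubmx N = 0 by rewrite -symN -trmx_dlsub Nl.2 trmx0.
pose N' := drsubmx N.
have NE : N = block_mx a%:M 0 0 N' by rewrite -[N]submxK Nl.1 Nl.2 Nur.
have quadH (A : 'M[R]_(1 + p)) (w : 'cV[R]_(1 + p)) :
    dotv w (H *m A *m H *m w) = dotv (H *m w) (A *m (H *m w)).
  by rewrite -!mulmxA dotv_mulr symH.
have MN : M = H *m N *m H.
  by rewrite /N !mulmxA HH mul1mx -mulmxA HH mulmx1.
have psdN' : psdmx N'.
  apply/psdmxP; split; first by rewrite /N' trmx_drsub symN.
  move=> u; have : 0 <= dotv (col_mx 0 u) (N *m col_mx 0 u).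
    by rewrite /N quadH; exact: posM.
  by rewrite NE mul_block_col !mul0mx mulmx0 !add0r dotv_col dot0v add0r.
have [S' [/psdmxP[symS' posS'] S'S']] := IH _ psdN'.
pose D : 'M[R]_(1 + p) := block_mx (Num.sqrt a)%:M 0 0 S'.
exists (H *m D *m H); split; last first.
  have -> : H *m D *m H *m (H *m D *m H) = H *m (D *m D) *m H.
    by rewrite -!mulmxA (mulmxA H H) HH mul1mx.
  rewrite MN mulmx_block !mul0mx !mulmx0 !addr0 add0r -scalar_mxM -expr2.
  by rewrite sqr_sqrtr // S'S' -NE.
apply/psdmxP; split.
  have symD : D^T = D.
    by rewrite /D tr_block_mx symS' !trmx0 tr_scalar_mx.
  by rewrite !trmx_mul symD symH mulmxA.
have posD (w : 'cV[R]_(1 + p)) : 0 <= dotv w (D *m w).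
  rewrite -[w]vsubmxK mul_block_col !mul0mx addr0 add0r dotv_col.
  by rewrite mul_scalar_mx dotvZr addr_ge0 // mulr_ge0 ?sqrtr_ge0 ?dotv_ge0.
by move=> w; rewrite quadH; exact: posD.
Qed.

(** The vectors [S^-1 w], for [S] the square root of [M], turn the largest
eigenvalue of [S^-1 A S^-1] into a comparison of [A] with [M]. *)
Lemma quad_le_lambda_max_invsqrtmx p (M A : 'M[R]_p) w :
  psdmx M -> M \in unitmx -> A^T = A ->
  dotv w (A *m w) <=
  lambda_max (invsqrtmx M *m A *m invsqrtmx M) * dotv w (M *m w).
Proof.
move=> psdM uM symA; have [S0 S0P] := psd_sqrt_exists psdM.
rewrite /invsqrtmx; set S := sqrtmx M.
have [/psdmxP[symS _] SS] : psdmx S /\ S *m S = M.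
  exact: (@xgetPex _ 0 [set S | psdmx S /\ S *m S = M] (ex_intro _ S0 S0P)).
have uS : S \in unitmx by move: uM; rewrite -SS unitmx_mul andbb.
have -> : dotv w (M *m w) = dotv (S *m w) (S *m w).
  by rewrite -SS dotv_mull symS mulmxA.
have -> : dotv w (A *m w) = dotv (S *m w) (invmx S *m A *m invmx S *m (S *m w)).
  by rewrite dotv_mull symS !mulmxA mulmxV // mul1mx -[A *m _ *m S]mulmxA mulVmx // mulmx1.
by apply: lambda_max_ge; rewrite !trmx_mul trmx_inv symS symA mulmxA.
Qed.

End psd_square_root.

(** * Expectations of random matrices *)

(** Integrability and the value of the expectation in one relation, which
makes linear computations compositional. *)
Definition has_mean (R : realType) d (S : measurableType d)
    (Q : probability S R) (f : S -> R) (r : R) : Prop :=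
  Q.-integrable [set: S] (fun w => (f w)%:E) /\
  (\int[Q]_w (f w)%:E)%E = r%:E.

Definition has_mean_mx (R : realType) d (S : measurableType d)
    (Q : probability S R) (p q : nat) (X : S -> 'M[R]_(p, q))
    (M : 'M[R]_(p, q)) : Prop :=
  forall i j, has_mean Q (fun w => X w i j) (M i j).

Section has_mean.
Context {R : realType} d {S : measurableType d} {Q : probability S R}.
Implicit Types f g : S -> R.

Lemma has_mean_cst r : has_mean Q (fun=> r) r.
Proof.
split; last by rewrite integral_cst //= probability_setT mule1.
by apply: finite_measure_integrable_cst.
Qed.

Lemma has_meanD f g r s : has_mean Q f r -> has_mean Q g s ->
  has_mean Q (fun w => f w + g w) (r + s).
Proof.
move=> [If Ef] [Ig Eg]; split; last by rewrite integralD_EFin // Ef Eg.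
by rewrite (_ : (fun w => _) = (EFin \o f) \+ (EFin \o g))%E //;
  apply: integrableD.
Qed.

Lemma has_meanZ a f r : has_mean Q f r -> has_mean Q (fun w => a * f w) (a * r).
Proof.
move=> [If Ef]; split.
  by rewrite (_ : (fun w => _) = (fun w => a%:E * (f w)%:E)%E) //;
    apply: integrableZl.
by under eq_integral do rewrite EFinM; rewrite integralZl // Ef.
Qed.

Lemma eq_has_mean f g r s : f =1 g -> r = s -> has_mean Q f r -> has_mean Q g s.
Proof. by move=> /funext -> ->. Qed.

Lemma has_mean_sum I (s : seq I) (F : I -> S -> R) (r : I -> R) :
  (forall i, has_mean Q (F i) (r i)) ->
  has_mean Q (fun w => \sum_(i <- s) F i w) (\sum_(i <- s) r i).
Proof.
move=> FP; elim: s => [|i s IH].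
  apply: (eq_has_mean _ _ (has_mean_cst 0)); last by rewrite big_nil.
  by move=> w; rewrite big_nil.
apply: (eq_has_mean _ _ (has_meanD (FP i) IH)); last by rewrite big_cons.
by move=> w; rewrite big_cons.
Qed.

Lemma le_has_mean f g r s : has_mean Q f r -> has_mean Q g s ->
  (forall w, f w <= g w) -> r <= s.
Proof.
move=> [If Ef] [Ig Eg] fg; rewrite -lee_fin -Ef -Eg.
by apply: le_integral => // w _; rewrite lee_fin.
Qed.

Lemma has_mean_mx_Emx p q (X : S -> 'M[R]_(p, q)) :
  mx_integrable Q X -> has_mean_mx Q X (Emx Q X).
Proof.
move=> IX i j; split; first exact: IX.
by rewrite /Emx mxE unlock fineK //; apply: integrable_fin_num => //; exact: IX.
Qed.

Lemma Emx_has_mean_mx p q (X : S -> 'M[R]_(p, q)) M :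
  has_mean_mx Q X M -> Emx Q X = M.
Proof.
move=> XM; apply/matrixP => i j; have [_ E] := XM i j.
by rewrite mxE unlock E.
Qed.

Lemma has_mean_mx_cst p q (M : 'M[R]_(p, q)) : has_mean_mx Q (fun=> M) M.
Proof. by move=> i j; exact: has_mean_cst. Qed.

Lemma has_mean_mxD p q (X Y : S -> 'M[R]_(p, q)) M N :
  has_mean_mx Q X M -> has_mean_mx Q Y N ->
  has_mean_mx Q (fun w => X w + Y w) (M + N).
Proof.
move=> XM YN i j; apply: (eq_has_mean _ _ (has_meanD (XM i j) (YN i j))).
  by move=> w; rewrite mxE.
by rewrite mxE.
Qed.

Lemma has_mean_mxZ p q a (X : S -> 'M[R]_(p, q)) M :
  has_mean_mx Q X M -> has_mean_mx Q (fun w => a *: X w) (a *: M).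
Proof.
move=> XM i j; apply: (eq_has_mean _ _ (has_meanZ a (XM i j))).
  by move=> w; rewrite mxE.
by rewrite mxE.
Qed.

Lemma has_mean_mxB p q (X Y : S -> 'M[R]_(p, q)) M N :
  has_mean_mx Q X M -> has_mean_mx Q Y N ->
  has_mean_mx Q (fun w => X w - Y w) (M - N).
Proof.
move=> XM YN; have := has_mean_mxD XM (has_mean_mxZ (-1) YN).
by rewrite scaleN1r; under eq_fun do rewrite scaleN1r.
Qed.

Lemma has_mean_mx_tr p q (X : S -> 'M[R]_(p, q)) M :
  has_mean_mx Q X M -> has_mean_mx Q (fun w => (X w)^T) M^T.
Proof.
move=> XM i j; apply: (eq_has_mean _ _ (XM j i)); last by rewrite mxE.
by move=> w; rewrite mxE.
Qed.

Lemma has_mean_mx_mull p q r (A : 'M[R]_(r, p)) (X : S -> 'M[R]_(p, q)) M :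
  has_mean_mx Q X M -> has_mean_mx Q (fun w => A *m X w) (A *m M).
Proof.
move=> XM i j; apply: (eq_has_mean _ _
    (has_mean_sum _ (fun k => has_meanZ (A i k) (XM k j)))).
  by move=> w; rewrite mxE.
by rewrite mxE.
Qed.

Lemma has_mean_mx_mulr p q r (A : 'M[R]_(q, r)) (X : S -> 'M[R]_(p, q)) M :
  has_mean_mx Q X M -> has_mean_mx Q (fun w => X w *m A) (M *m A).
Proof.
move=> /has_mean_mx_tr /(has_mean_mx_mull A^T) /has_mean_mx_tr.
rewrite trmx_mul !trmxK; under eq_fun do rewrite trmx_mul !trmxK.
exact.
Qed.

Lemma has_mean_dotv p (X : S -> 'cV[R]_p) M u :
  has_mean_mx Q X M -> has_mean Q (fun w => dotv u (X w)) (dotv u M).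
Proof.
move=> XM.
exact: (has_mean_sum _ (fun i => has_meanZ (u i 0) (XM i 0))).
Qed.

Lemma has_mean_quad p q (X : S -> 'M[R]_(p, q)) M u v :
  has_mean_mx Q X M ->
  has_mean Q (fun w => dotv u (X w *m v)) (dotv u (M *m v)).
Proof. by move=> /(has_mean_mx_mulr v) /(has_mean_dotv u). Qed.

Lemma has_mean_mx_cov p q (X : S -> 'M[R]_(p, q)) M N :
  has_mean_mx Q X M -> has_mean_mx Q (fun w => X w *m (X w)^T) N ->
  has_mean_mx Q (fun w => (X w - M) *m (X w - M)^T) (N - M *m M^T).
Proof.
move=> XM XN.
have := has_mean_mxB XN (has_mean_mxB (has_mean_mxD
  (has_mean_mx_mull M (has_mean_mx_tr XM)) (has_mean_mx_mulr M^T XM))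
  (has_mean_mx_cst (M *m M^T))).
rewrite addrK; congr has_mean_mx; apply/funext => w.
have -> : (X w - M)^T = (X w)^T - M^T by rewrite linearB.
by rewrite mulmxBl !mulmxBr; apply/matrixP => i j; rewrite !mxE; ring.
Qed.

End has_mean.

(** * Independence and Tonelli's theorem *)

Lemma measurable_partial_integral (R : realType) d0 (T0 : measurableType d0)
    d (T : measurableType d) (P : probability T R)
    d1 (X1 : measurableType d1) d2 (X2 : measurableType d2)
    (f1 : T0 -> X1) (f2 : T -> X2) (F : X1 * X2 -> \bar R) :
  measurable_fun setT f1 -> measurable_fun setT f2 ->
  measurable_fun setT F -> (forall x, (0 <= F x)%E) ->
  measurable_fun setT (fun w => \int[P]_w' F (f1 w, f2 w'))%E.
Proof.
move=> mf1 mf2 mF F0.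
pose F' (z : X1 * T) := F (z.1, f2 z.2).
have mF' : measurable_fun setT F'.
  have m12 : measurable_fun setT (fun z : X1 * T => (z.1, f2 z.2)).
    apply: measurable_fun_pair; first exact: measurable_fst.
    exact: (@measurableT_comp _ _ _ _ _ _ f2 setT snd mf2 measurable_snd).
  exact: (@measurableT_comp _ _ _ _ _ _ F setT _ mF m12).
have mI := @measurable_fun_fubini_tonelli_F _ _ _ _ _ P F' mF' (fun=> F0 _).
exact: (@measurableT_comp _ _ _ _ _ _ _ setT f1 mI mf1).
Qed.

Section tonelli_independent.
Context {R : realType} d {T : measurableType d} (P : probability T R)
  d1 {X1 : measurableType d1} d2 {X2 : measurableType d2}.
Variables (f1 : T -> X1) (f2 : T -> X2).

(** Independence makes the law of the pair the product of the laws, and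
Tonelli's theorem applies to nonnegative functions without any integrability
condition. *)
Lemma ge0_integral_independent (F : X1 * X2 -> \bar R) :
  measurable_fun setT f1 -> measurable_fun setT f2 ->
  (forall A C, measurable A -> measurable C ->
    P ((f1 @^-1` A) `&` (f2 @^-1` C)) = (P (f1 @^-1` A) * P (f2 @^-1` C))%E) ->
  measurable_fun setT F -> (forall x, (0 <= F x)%E) ->
  (\int[P]_w F (f1 w, f2 w) = \int[P]_w \int[P]_w' F (f1 w, f2 w'))%E.
Proof.
move=> mf1 mf2 indep mF F0.
pose f12 w := (f1 w, f2 w).
have mf12 : measurable_fun setT f12 by exact: measurable_fun_pair.
pose g1 : {mfun T >-> X1} := HB.pack f1 (isMeasurableFun.Build _ _ _ _ _ mf1).
pose g2 : {mfun T >-> X2} := HB.pack f2 (isMeasurableFun.Build _ _ _ _ _ mf2).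
pose g12 : {mfun T >-> (X1 * X2)%type} :=
  HB.pack f12 (isMeasurableFun.Build _ _ _ _ _ mf12).
transitivity (\int[distribution P g12]_z F z)%E.
  by rewrite ge0_integral_distribution.
rewrite (@eq_measure_integral _ _ R setT
    (distribution P g1 \x distribution P g2)%E (distribution P g12) F);
  last first.
  move=> A mA _; apply/esym.
  by apply: product_measure_unique => // B C mB mC; exact: indep.
rewrite fubini_tonelli1 // ge0_integral_distribution //; last 2 first.
- exact: measurable_fun_fubini_tonelli_F.
- by move=> x; apply: integral_ge0.
apply: eq_integral => w _ /=.
by rewrite /fubini_F ge0_integral_distribution //; exact: measurable_fun_pair2.
Qed.

End tonelli_independent.

(** A sample is a matrix paired with a pair of vectors: its Borel sets can be
those of a [borelType] only if products of spaces are pointed as well. *)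
HB.instance Definition _ (E F : ptopologicalType) := Pointed.on (E * F)%type.

(** Borel sets as the measurable sets of a type, which gives access to the
theory of measurable functions. *)
Definition borelType (E : ptopologicalType) :=
  g_sigma_algebraType [set U : set E | open U].

Section borel_elements.
Context {R : realType}.

Lemma random_element_measurable d (T : measurableType d)
    (E : ptopologicalType) (X : T -> E) :
  random_element X -> measurable_fun setT (X : T -> borelType E).
Proof. by move=> rX _ A mA; rewrite setTI; exact: rX. Qed.

Lemma continuous_borel (E F : ptopologicalType) (f : E -> F) :
  continuous f -> measurable_fun setT (f : borelType E -> borelType F).
Proof.
move=> cf.
apply: (@measurability _ _ (borelType E) (borelType F) setT f [set U | open U]
  erefl) => _ [U oU <-].
rewrite setTI; apply: sub_sigma_algebra.
by move/continuousP: cf => /(_ U oU).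
Qed.

Lemma random_element_comp d (T : measurableType d) (E F : ptopologicalType)
    (X : T -> E) (f : E -> F) :
  random_element X -> continuous f ->
  measurable_fun setT (fun w => f (X w) : borelType F).
Proof.
move=> rX cf _ A mA; rewrite setTI; apply: (rX (f @^-1` A)).
by have := continuous_borel cf measurableT mA; rewrite setTI.
Qed.

Lemma continuous_borel_real (E : ptopologicalType) (f : E -> R) :
  continuous f -> measurable_fun setT (f : borelType E -> R).
Proof.
move=> cf; apply: (measurability _ (RGenOpens.measurableE R)).
move=> _ [_ [a [b ->] <-]]; rewrite setTI; apply: sub_sigma_algebra.
by move/continuousP: cf => /(_ `]a, b[%classic (interval_open _ _)); exact.
Qed.

Lemma same_law_integral d (S : measurableType d) (Q : probability S R)
    d' (T : measurableType d') (P : probability T R)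
    (E : ptopologicalType) (X : S -> E) (Y : T -> E) (F : borelType E -> \bar R) :
  random_element X -> random_element Y -> same_law Q P X Y ->
  measurable_fun setT F -> (forall x, (0 <= F x)%E) ->
  (\int[P]_w F (Y w) = \int[Q]_s F (X s))%E.
Proof.
move=> rX rY XY mF F0.
pose gX : {mfun S >-> borelType E} := HB.pack (X : S -> borelType E)
  (isMeasurableFun.Build _ _ _ _ _ (random_element_measurable rX)).
pose gY : {mfun T >-> borelType E} := HB.pack (Y : T -> borelType E)
  (isMeasurableFun.Build _ _ _ _ _ (random_element_measurable rY)).
transitivity (\int[distribution P gY]_z F z)%E.
  by rewrite ge0_integral_distribution.
transitivity (\int[distribution Q gX]_z F z)%E; last first.
  by rewrite ge0_integral_distribution.
by apply: eq_measure_integral => A mA _; apply/esym; exact: XY.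
Qed.

End borel_elements.

(** * The past of an independent sequence *)

Section past.
Context {R : realType} d {T : measurableType d} (P : probability T R)
  {E : ptopologicalType}.
Variable X : nat -> T -> E.

(** Stability under intersection is what lets independence, which is a
statement on cylinders, extend to the whole sigma-algebra of the past. *)
Definition past_cylinders (t : nat) : set (set T) :=
  [set A | exists C : nat -> set E, (forall s, borel_set (C s)) /\
    A = \bigcap_(s in [set` iota 0 t]) (X s @^-1` C s)].

Definition pastType (t : nat) := g_sigma_algebraType (past_cylinders t).

Let borel_setT : @borel_set E setT.
Proof. exact: (@measurableT _ (borelType E)). Qed.

Lemma past_cylinders_setI t : setI_closed (past_cylinders t).
Proof.
move=> _ _ [C [bC ->]] [C' [bC' ->]].
exists (fun s => C s `&` C' s); split.
  by move=> s; apply: (@measurableI _ (borelType E)); [exact: bC | exact: bC'].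
by rewrite -bigcapI.
Qed.

Lemma past_cylinders_setT t : past_cylinders t setT.
Proof. by exists (fun=> setT); split=> //; rewrite bigcapT. Qed.

Lemma sub_past_cylinders t t' : (t <= t')%N ->
  past_cylinders t `<=` past_cylinders t'.
Proof.
move=> tt' _ [C [bC ->]].
exists (fun s => if (s < t)%N then C s else setT); split.
  by move=> s; case: ifP.
apply/seteqP; split => w /= XC s; have := XC s; rewrite /= !mem_iota /= !add0n.
  by case: ifP => // st + _; exact.
by move=> + st; rewrite st; apply; rewrite (leq_trans st).
Qed.

Lemma sub_past t t' A : (t <= t')%N ->
  @measurable _ (pastType t) A -> @measurable _ (pastType t') A.
Proof.
move=> tt'; apply: smallest_sub; first exact: smallest_sigma_algebra.
by apply: subset_trans (@sub_sigma_algebra _ _ _); exact: sub_past_cylinders.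
Qed.

Hypothesis rX : forall t, random_element (X t).

Lemma past_cylinders_measurable t :
  past_cylinders t `<=` @measurable _ T.
Proof.
move=> _ [C [bC ->]]; rewrite bigcap_seq; apply: bigsetI_measurable => s _.
exact: rX.
Qed.

Lemma past_measurable t A :
  @measurable _ (pastType t) A -> @measurable _ T A.
Proof.
by apply: smallest_sub; [exact: sigma_algebra_measurable |
  exact: past_cylinders_measurable].
Qed.

Lemma past_id_measurable t : measurable_fun setT (id : T -> pastType t).
Proof. by move=> _ A mA; rewrite setTI; exact: past_measurable mA. Qed.

Lemma past_funW t t' dU (U : measurableType dU) (f : T -> U) : (t <= t')%N ->
  measurable_fun setT (f : pastType t -> U) ->
  measurable_fun setT (f : pastType t' -> U).
Proof.
by move=> tt' mf _ A mA; apply: sub_past tt' _; exact: mf.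
Qed.

Lemma past_sample_measurable t :
  measurable_fun setT (X t : pastType t.+1 -> borelType E).
Proof.
move=> _ A mA; rewrite setTI; apply: sub_sigma_algebra.
exists (fun s => if s == t then A else setT); split.
  by move=> s; case: ifP.
apply/seteqP; split => w /=; last first.
  have tt : t \in iota 0 t.+1 by rewrite mem_iota ltnSn.
  by move=> /(_ t tt) /=; rewrite eqxx.
by move=> XtA s _; case: eqP => [->|].
Qed.

Hypothesis indX : mutually_independent P X.

(** Two finite measures that agree on the cylinders agree on the past:
[A |-> P (A `&` (X t @^-1` C))] and the multiple of [P] by the probability of
[X t @^-1` C]. *)
Lemma past_independent t A C : @measurable _ (pastType t) A -> borel_set C ->
  P (A `&` (X t @^-1` C)) = (P A * P (X t @^-1` C))%E.
Proof.
move=> pA bC.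
have mC : measurable (X t @^-1` C) by exact: rX.
pose r : {nonneg R} := NngNum (fine_ge0 (measure_ge0 P (X t @^-1` C))).
have rE : r%:num%:E = P (X t @^-1` C) by rewrite fineK // fin_num_measure.
have mscaleE B : mscale r P B = (P (X t @^-1` C) * P B)%E by rewrite /mscale rE.
have : mrestr P mC A = mscale r P A.
  apply: (@g_sigma_algebra_measure_unique _ _ _ (past_cylinders t) _
    (fun=> setT) _ _ (mrestr P mC) (mscale r P)) => //.
  - exact: past_cylinders_measurable.
  - by move=> _; exact: past_cylinders_setT.
  - exact: bigcup_const.
  - exact: past_cylinders_setI.
  - move=> _ [D [bD ->]].
    transitivity (P (X t @^-1` C) * P (\bigcap_(s in [set` iota 0 t]) (X s @^-1` D s)))%E;
      last by exact/esym/mscaleE.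
    rewrite /= /mrestr.
    pose D' s := if s == t then C else D s.
    have bD' s : borel_set (D' s) by rewrite /D'; case: ifP.
    have eqD : forall s, s \in iota 0 t -> D' s = D s.
      by move=> s; rewrite mem_iota add0n /D' => /andP[_ st]; rewrite ltn_eqF.
    have tnot : t \notin iota 0 t by rewrite mem_iota add0n ltnn.
    have -> : \bigcap_(s in [set` iota 0 t]) (X s @^-1` D s) =
              \bigcap_(s in [set` iota 0 t]) (X s @^-1` D' s).
      by apply: eq_bigcapr => s /eqD ->.
    have D't : D' t = C by rewrite /D' eqxx.
    have E1 := indX (iota_uniq 0 t) (fun s _ => bD' s).
    have u2 : uniq (t :: iota 0 t) by rewrite /= tnot iota_uniq.
    have E2 := indX u2 (fun s _ => bD' s).
    rewrite big_cons -E1 D't in E2.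
    rewrite -E2; congr (P _).
    by rewrite setIC !bigcap_seq big_cons D't.
  - by move=> _; rewrite /= /mrestr setTI ltey_eq fin_num_measure.
by rewrite mscaleE /mrestr muleC.
Qed.

(** Conditioning on the past: a function of the past and of the next sample is
integrated by freezing the past and averaging over an independent copy. *)
Lemma past_freeze dS (S : measurableType dS) (Q : probability S R)
    (x : S -> E) t (F : pastType t * borelType E -> \bar R) :
  random_element x -> same_law Q P x (X t) ->
  measurable_fun setT F -> (forall z, (0 <= F z)%E) ->
  (\int[P]_w F (w, X t w) = \int[P]_w \int[Q]_s F (w, x s))%E.
Proof.
move=> rx lawx mF F0.
rewrite (@ge0_integral_independent _ _ _ P _ (pastType t) _ (borelType E)
  id (X t) F) //.
- apply: eq_integral => w _.
  apply: (@same_law_integral _ _ _ Q _ _ _ _ x (X t) (fun e => F (w, e))) => //.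
  exact: (@measurable_fun_pair2 _ _ _ (pastType t) (borelType E) _ F w).
- exact: past_id_measurable.
- exact: random_element_measurable.
- by move=> A C; exact: past_independent.
Qed.

End past.

(** * Measurable random vectors *)

(** Entrywise measurability is Borel measurability, in the form that passes
through sums and products. *)
Definition measurable_mx (R : realType) d (T : measurableType d) (p q : nat)
    (X : T -> 'M[R]_(p, q)) : Prop :=
  forall i j, measurable_fun setT (fun w => X w i j).

Section measurable_mx.
Context {R : realType} d {T : measurableType d}.

Lemma measurable_sumr I (s : seq I) (F : I -> T -> R) :
  (forall i, measurable_fun setT (F i)) ->
  measurable_fun setT (fun w => \sum_(i <- s) F i w).
Proof.
move=> mF; elim: s => [|i s IH].
  by under eq_fun do rewrite big_nil; exact: measurable_cst.
by under eq_fun do rewrite big_cons; exact: measurable_funD.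
Qed.

Lemma measurable_mx_cst p q (M : 'M[R]_(p, q)) :
  measurable_mx (fun=> M : 'M[R]_(p, q)) (T := T).
Proof. by move=> i j; exact: measurable_cst. Qed.

Lemma measurable_mxD p q (X Y : T -> 'M[R]_(p, q)) :
  measurable_mx X -> measurable_mx Y -> measurable_mx (fun w => X w + Y w).
Proof.
by move=> mX mY i j; under eq_fun do rewrite mxE; exact: measurable_funD.
Qed.

Lemma measurable_mxZ p q a (X : T -> 'M[R]_(p, q)) :
  measurable_mx X -> measurable_mx (fun w => a *: X w).
Proof.
move=> mX i j; under eq_fun do rewrite mxE.
by apply: measurable_funM => //; exact: measurable_cst.
Qed.

Lemma measurable_mxB p q (X Y : T -> 'M[R]_(p, q)) :
  measurable_mx X -> measurable_mx Y -> measurable_mx (fun w => X w - Y w).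
Proof.
by move=> mX mY i j; under eq_fun do rewrite !mxE; exact: measurable_funB.
Qed.

Lemma measurable_mx_tr p q (X : T -> 'M[R]_(p, q)) :
  measurable_mx X -> measurable_mx (fun w => (X w)^T).
Proof. by move=> mX i j; under eq_fun do rewrite mxE; exact: mX. Qed.

Lemma measurable_mxM p q r (X : T -> 'M[R]_(p, q)) (Y : T -> 'M[R]_(q, r)) :
  measurable_mx X -> measurable_mx Y -> measurable_mx (fun w => X w *m Y w).
Proof.
move=> mX mY i j; under eq_fun do rewrite mxE.
by apply: measurable_sumr => k; exact: measurable_funM.
Qed.

Lemma measurable_dotv p (X Y : T -> 'cV[R]_p) :
  measurable_mx X -> measurable_mx Y ->
  measurable_fun setT (fun w => dotv (X w) (Y w)).
Proof. by move=> mX mY; apply: measurable_sumr => k; exact: measurable_funM. Qed.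

Lemma measurable_mx_comp d' (U : measurableType d') (f : U -> T) p q
    (X : T -> 'M[R]_(p, q)) :
  measurable_fun setT f -> measurable_mx X -> measurable_mx (fun u => X (f u)).
Proof.
move=> mf mX i j.
exact: (@measurableT_comp _ _ _ _ _ _ (fun w => X w i j) setT f (mX i j) mf).
Qed.

End measurable_mx.

(** * One step of the method *)

Notation state R n m := ('cV[R]_n * 'cV[R]_m)%type.

Definition dotp (R : realType) n m (z z' : state R n m) : R :=
  dotv z.1 z'.1 + dotv z.2 z'.2.

Notation sqn z := (dotp z z).

Definition measurable_state (R : realType) n m d (T : measurableType d)
    (Z : T -> state R n m) : Prop :=
  measurable_mx (fun w => (Z w).1) /\ measurable_mx (fun w => (Z w).2).

Section state.
Context {R : realType} {n m : nat}.
Implicit Types z : state R n m.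

Lemma dotpC z1 z2 : dotp z1 z2 = dotp z2 z1.
Proof. by rewrite /dotp !(dotvC z1.1, dotvC z1.2). Qed.

Lemma dotpDl z1 z2 z : dotp (z1 + z2) z = dotp z1 z + dotp z2 z.
Proof. by rewrite /dotp !dotvDl; ring. Qed.

Lemma dotpZl a z1 z : dotp (a *: z1) z = a * dotp z1 z.
Proof. by rewrite /dotp !dotvZl; ring. Qed.

Lemma sqn_ge0 z : 0 <= sqn z.
Proof. by rewrite addr_ge0 ?dotv_ge0. Qed.

Lemma sqnD z1 z2 : sqn (z1 + z2) = sqn z1 + 2 * dotp z1 z2 + sqn z2.
Proof.
by rewrite dotpDl !(dotpC _ (z1 + z2)) !dotpDl (dotpC z2 z1); ring.
Qed.

Lemma sqnZ a z : sqn (a *: z) = a ^+ 2 * sqn z.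
Proof. by rewrite dotpZl dotpC dotpZl mulrA expr2. Qed.

Lemma sqnN z : sqn (- z) = sqn z.
Proof. by rewrite -scaleN1r sqnZ sqrrN expr1n mul1r. Qed.

(** Young's inequality with weight [c]. *)
Lemma sqnD_le c z1 z2 : 0 < c ->
  sqn (z1 + z2) <= (1 + c) * sqn z1 + (1 + c^-1) * sqn z2.
Proof.
move=> c0.
have h : 0 <= c ^+ 2 * sqn z1 - 2 * c * dotp z1 z2 + sqn z2.
  have := sqn_ge0 (c *: z1 - z2).
  rewrite sqnD sqnZ sqnN dotpZl dotpC -scaleN1r dotpZl dotpC => h.
  by apply: le_trans h _; rewrite le_eqVlt; apply/orP; left; apply/eqP; ring.
rewrite sqnD -subr_ge0 (_ : _ - _ =
  c^-1 * (c ^+ 2 * sqn z1 - 2 * c * dotp z1 z2 + sqn z2)).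
  by rewrite mulr_ge0 // invr_ge0 ltW.
by field; rewrite gt_eqF.
Qed.

Context d {T : measurableType d}.
Implicit Types Z : T -> state R n m.

Lemma measurable_stateD Z1 Z2 :
  measurable_state Z1 -> measurable_state Z2 ->
  measurable_state (fun w => Z1 w + Z2 w).
Proof. by move=> [? ?] [? ?]; split; exact: measurable_mxD. Qed.

Lemma measurable_stateZ a Z :
  measurable_state Z -> measurable_state (fun w => a *: Z w).
Proof. by move=> [? ?]; split; exact: measurable_mxZ. Qed.

Lemma measurable_stateB Z1 Z2 :
  measurable_state Z1 -> measurable_state Z2 ->
  measurable_state (fun w => Z1 w - Z2 w).
Proof. by move=> [? ?] [? ?]; split; exact: measurable_mxB. Qed.

Lemma measurable_state_cst z : measurable_state (fun _ : T => z).
Proof. by split; exact: measurable_mx_cst. Qed.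

Lemma measurable_sqn Z : measurable_state Z ->
  measurable_fun setT (fun w => sqn (Z w)).
Proof. by move=> [? ?]; apply: measurable_funD; exact: measurable_dotv. Qed.

Lemma measurable_state_comp d' (U : measurableType d') (f : U -> T) Z :
  measurable_fun setT f -> measurable_state Z ->
  measurable_state (fun u => Z (f u)).
Proof.
move=> mf [m1 m2].
by split; [exact: (measurable_mx_comp mf m1) | exact: (measurable_mx_comp mf m2)].
Qed.

End state.

(** The part of a step that depends on the sampled matrix alone; it is the
matrix [I - eta J + eta^2 J^2], where [J] is the skew block matrix of [B]. *)
Definition det_step (R : realType) n m (eta : R) (B : 'M[R]_(n, m))
    (z : state R n m) : state R n m :=
  (z.1 - eta *: (B *m z.2) - eta ^+ 2 *: (B *m B^T *m z.1),
   z.2 + eta *: (B^T *m z.1) - eta ^+ 2 *: (B^T *m B *m z.2)).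

(** The part of a step that is linear in the sampled noise [g]. *)
Definition seg_noise (R : realType) n m (eta : R) (B : 'M[R]_(n, m))
    (g : state R n m) : state R n m :=
  (- (eta *: (g.1 + eta *: (B *m g.2))), eta *: (g.2 - eta *: (B^T *m g.1))).

Section seg_step.
Context {R : realType} {n m : nat}.

Lemma seg_stepE eta (s : sample R n m) z :
  seg_step eta s z = det_step eta (Bxi s) z + seg_noise eta (Bxi s) (gxi s).
Proof.
case: z => x y; case: s => B [a b].
rewrite /seg_step /det_step /seg_noise /Bxi /gx /gy /gxi /=.
congr pair => /=; rewrite ?mulmxDr ?mulmxN -!scalemxAr ?mulmxDr ?mulmxN.
  by rewrite mulmxA; apply/matrixP => i j; rewrite ![in LHS]mxE ![in RHS]mxE; ring.
rewrite -?scalemxAr ?mulmxDr mulmxA.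
by apply/matrixP => i j; rewrite ![in LHS]mxE ![in RHS]mxE; ring.
Qed.

(** The bilinear coupling is skew, so that the terms of odd order in [eta]
cancel. *)
Lemma sqn_det_step eta (B : 'M[R]_(n, m)) z :
  sqn (det_step eta B z) = sqn z
   - eta ^+ 2 * (dotv z.1 (B *m B^T *m z.1) + dotv z.2 (B^T *m B *m z.2))
   + eta ^+ 4 * (dotv z.1 (B *m B^T *m (B *m B^T) *m z.1)
                 + dotv z.2 (B^T *m B *m (B^T *m B) *m z.2)).
Proof.
case: z => x y; rewrite /dotp /det_step /=.
set a := B *m y; set b := B^T *m x.
have e1 : B *m B^T *m x = B *m b by rewrite mulmxA.
have e2 : B^T *m B *m y = B^T *m a by rewrite mulmxA.
have e3 : B *m B^T *m (B *m B^T) *m x = B *m (B^T *m (B *m b)) by rewrite !mulmxA.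
have e4 : B^T *m B *m (B^T *m B) *m y = B^T *m (B *m (B^T *m a)) by rewrite !mulmxA.
rewrite e1 e2 e3 e4.
have f1 : dotv x (B *m (B^T *m (B *m b))) = dotv (B *m b) (B *m b).
  by rewrite dotv_mulr -/b dotv_mulr trmxK.
have f2 : dotv y (B^T *m (B *m (B^T *m a))) = dotv (B^T *m a) (B^T *m a).
  by rewrite dotv_mulr trmxK -/a dotv_mulr.
have f3 : dotv x (B *m b) = dotv b b by rewrite dotv_mulr.
have f4 : dotv y (B^T *m a) = dotv a a by rewrite dotv_mulr trmxK.
have f5 : dotv a (B *m b) = dotv b (B^T *m a).
  by rewrite dotv_mulr dotvC.
have f6 : dotv x a = dotv y b by rewrite dotvC dotv_mull.
rewrite f1 f2 f3 f4 !(dotvDl, dotvNl) !(dotvDr, dotvNr) !(dotvZl, dotvZr).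
rewrite !(dotvC a x) !(dotvC (B *m b)) !(dotvC (B^T *m a)) !(dotvC b y).
rewrite f3 f4 f5 f6; ring.
Qed.

Lemma sqn_seg_noise eta (B : 'M[R]_(n, m)) g :
  sqn (seg_noise eta B g) = eta ^+ 2 * (sqn g
   + eta ^+ 2 * (dotv g.1 (B *m B^T *m g.1) + dotv g.2 (B^T *m B *m g.2))).
Proof.
case: g => x y; rewrite /dotp /seg_noise /=.
have f3 : dotv x (B *m B^T *m x) = dotv (B^T *m x) (B^T *m x).
  by rewrite -mulmxA dotv_mulr.
have f4 : dotv y (B^T *m B *m y) = dotv (B *m y) (B *m y).
  by rewrite -mulmxA dotv_mulr trmxK.
have f6 : dotv x (B *m y) = dotv y (B^T *m x) by rewrite dotvC dotv_mull.
rewrite f3 f4 !dotvNl !dotvNr !dotvZl !dotvZr !(dotvDl, dotvNl) !(dotvDr, dotvNr).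
rewrite !(dotvZl, dotvZr) (dotvC (B *m y)) (dotvC (B^T *m x) y) f6; ring.
Qed.

End seg_step.

Section sample_measurability.
Context {R : realType} {n m : nat}.

Lemma measurable_seg_noise d (T : measurableType d) eta
    (X : T -> 'M[R]_(n, m)) (Z : T -> state R n m) :
  measurable_mx X -> measurable_state Z ->
  measurable_state (fun w => seg_noise eta (X w) (Z w)).
Proof.
move=> mX [mZ1 mZ2]; split=> /=.
  under eq_fun do rewrite -scaleN1r.
  do 2 apply: measurable_mxZ; apply: measurable_mxD => //.
  by apply: measurable_mxZ; apply: measurable_mxM.
apply: measurable_mxZ; apply: measurable_mxB => //; apply: measurable_mxZ.
by apply: measurable_mxM => //; exact: measurable_mx_tr.
Qed.

Lemma measurable_det_step d (T : measurableType d) eta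
    (X : T -> 'M[R]_(n, m)) (Z : T -> state R n m) :
  measurable_mx X -> measurable_state Z ->
  measurable_state (fun w => det_step eta (X w) (Z w)).
Proof.
move=> mX [mZ1 mZ2]; have mXt := measurable_mx_tr mX; split=> /=.
  apply: measurable_mxB; last first.
    apply: measurable_mxZ; apply: measurable_mxM => //.
    exact: measurable_mxM.
  by apply: measurable_mxB => //; apply: measurable_mxZ; apply: measurable_mxM.
apply: measurable_mxB; last first.
    apply: measurable_mxZ; apply: measurable_mxM => //.
    exact: measurable_mxM.
by apply: measurable_mxD => //; apply: measurable_mxZ; apply: measurable_mxM.
Qed.

Context d {S : measurableType d} (Q : probability S R) (xi : S -> sample R n m).
Hypothesis rxi : random_element xi.

Lemma gxi_measurable : measurable_fun setT
  (fun w => gxi (xi w) : borelType (state R n m)).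
Proof.
apply: (random_element_comp rxi) => s.
exact: (@cvg_snd _ _ (nbhs s.1) (nbhs s.2)).
Qed.

Lemma Bxi_measurable : measurable_fun setT
  (fun w => Bxi (xi w) : borelType 'M[R]_(n, m)).
Proof.
apply: (random_element_comp rxi) => s.
exact: (@cvg_fst _ _ (nbhs s.1) (nbhs s.2)).
Qed.

Lemma borel_measurable_mx p q :
  measurable_mx (id : borelType 'M[R]_(p, q) -> 'M[R]_(p, q)).
Proof. by move=> i j; apply: continuous_borel_real; exact: coord_continuous. Qed.

Lemma borel_measurable_state :
  measurable_state (id : borelType (state R n m) -> state R n m).
Proof.
split=> i j; apply: continuous_borel_real => s.
  apply: (@continuous_comp _ _ _ fst (fun v : 'cV[R]_n => v i j)).
    exact: (@cvg_fst _ _ (nbhs s.1) (nbhs s.2)).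
  exact: coord_continuous.
apply: (@continuous_comp _ _ _ snd (fun v : 'cV[R]_m => v i j)).
  exact: (@cvg_snd _ _ (nbhs s.1) (nbhs s.2)).
exact: coord_continuous.
Qed.

End sample_measurability.

Section noise.
Context {R : realType} d {S : measurableType d} (Q : probability S R)
  {n m : nat} (xi : S -> sample R n m) (sB sB2 sg eta : R).
Hypothesis rxi : random_element xi.
Hypothesis A1 : assumption_A1 Q xi sB sB2.
Hypothesis A2 : assumption_A2 Q xi sg.
Hypothesis etaM_le : forall x,
  eta ^+ 2 * dotv x (meanM Q xi *m x) <= 2^-1 * dotv x x.
Hypothesis etaMh_le : forall y,
  eta ^+ 2 * dotv y (meanMh Q xi *m y) <= 2^-1 * dotv y y.

Lemma measurable_state_gxi : measurable_state (fun w => gxi (xi w)).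
Proof.
exact: (measurable_state_comp (gxi_measurable rxi) borel_measurable_state).
Qed.

Lemma integral_sqn_gxi_le :
  (\int[Q]_w (sqn (gxi (xi w)))%:E <= (sg ^+ 2)%:E)%E.
Proof.
have := A2_var A2; rewrite unlock.
by under eq_integral do rewrite !sqr_enorm.
Qed.

Lemma integrable_sqn_gxi :
  Q.-integrable setT (fun w => (sqn (gxi (xi w)))%:E).
Proof.
apply/integrableP; split.
  by apply/measurable_EFinP; apply: measurable_sqn; exact: measurable_state_gxi.
under eq_integral do rewrite gee0_abs ?lee_fin ?sqn_ge0 //.
by apply: le_lt_trans integral_sqn_gxi_le _; rewrite ltry.
Qed.

(** The variance bound gives integrability because [`|t| <= 1 + t ^+ 2]. *)
Lemma integrable_le_sqn_gxi p (X : S -> 'cV[R]_p) c :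
  measurable_mx X -> (forall w, dotv (X w) (X w) <= c * sqn (gxi (xi w))) ->
  mx_integrable Q X.
Proof.
move=> mX Xc i j; rewrite ord1.
apply: (@le_integrable _ _ _ Q setT measurableT _
    (fun w => (1 + c * sqn (gxi (xi w)))%:E)).
- by apply/measurable_EFinP; exact: mX.
- move=> w _; rewrite !abse_EFin lee_fin.
  have c0 : 0 <= c * sqn (gxi (xi w)) by apply: le_trans (Xc w); exact: dotv_ge0.
  rewrite [leRHS]ger0_norm; last by rewrite addr_ge0.
  have h : X w i 0 ^+ 2 <= c * sqn (gxi (xi w)).
    apply: le_trans (Xc w); rewrite /dotv (bigD1 i) //= -expr2 lerDl.
    by apply: sumr_ge0 => k _; rewrite -expr2 sqr_ge0.
  rewrite -(real_normK (num_real _)) in h.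
  have := sqr_ge0 (`|X w i 0| - 1); have := normr_ge0 (X w i 0); nra.
- rewrite (_ : (fun w => _) = fun w =>
    (1%:E + c%:E * (sqn (gxi (xi w)))%:E)%E) //.
  apply: integrableD => //; first exact: finite_measure_integrable_cst.
  by apply: integrableZl => //; exact: integrable_sqn_gxi.
Qed.

Lemma has_mean_gx : has_mean_mx Q (fun w => (gxi (xi w)).1) 0.
Proof.
rewrite -(A2_meanx A2); apply: has_mean_mx_Emx.
apply: (@integrable_le_sqn_gxi _ _ 1); first exact: measurable_state_gxi.1.
by move=> w; rewrite mul1r lerDl dotv_ge0.
Qed.

Lemma has_mean_gy : has_mean_mx Q (fun w => (gxi (xi w)).2) 0.
Proof.
rewrite -(A2_meany A2); apply: has_mean_mx_Emx.
apply: (@integrable_le_sqn_gxi _ _ 1); first exact: measurable_state_gxi.2.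
by move=> w; rewrite mul1r lerDr dotv_ge0.
Qed.

Lemma integrable_sqn_seg_noise A :
  Q.-integrable setT (fun w => (sqn (seg_noise eta A (gxi (xi w))))%:E).
Proof.
pose c := `|opnorm (A *m A^T)| + `|opnorm (A^T *m A)|.
apply: (@le_integrable _ _ _ Q setT measurableT _
    (fun w => (eta ^+ 2 * (1 + eta ^+ 2 * c))%:E * (sqn (gxi (xi w)))%:E)%E).
- apply/measurable_EFinP; apply: measurable_sqn; apply: measurable_seg_noise.
    exact: measurable_mx_cst.
  exact: measurable_state_gxi.
- move=> w _; rewrite -EFinM !abse_EFin lee_fin.
  rewrite ger0_norm ?sqn_ge0 //; apply: le_trans (ler_norm _).
  rewrite sqn_seg_noise -[leRHS]mulrA ler_wpM2l ?sqr_ge0 //.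
  rewrite mulrDl mul1r lerD2l -[leRHS]mulrA ler_wpM2l ?sqr_ge0 //.
  case: (gxi _) => x y /=; rewrite /dotp mulrDr /=.
  have h1 := dotv_opnorm_le x (ler_norm (opnorm (A *m A^T))).
  have h2 := dotv_opnorm_le y (ler_norm (opnorm (A^T *m A))).
  apply: lerD; first apply: le_trans h1 _; last apply: le_trans h2 _.
    by rewrite ler_wpM2r ?dotv_ge0 // lerDl.
  by rewrite ler_wpM2r ?dotv_ge0 // lerDr.
- by apply: integrableZl => //; exact: integrable_sqn_gxi.
Qed.

(** For a fixed matrix the noise vector is linear in [g] and inherits its zero
mean. *)
Lemma has_mean_seg_noise A u :
  has_mean Q (fun w => dotp u (seg_noise eta A (gxi (xi w)))) 0.
Proof.
have h1 := has_mean_mxZ (-1) (has_mean_mxZ eta (has_mean_mxD has_mean_gx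
  (has_mean_mxZ eta (has_mean_mx_mull A has_mean_gy)))).
have h2 := has_mean_mxZ eta (has_mean_mxB has_mean_gy
  (has_mean_mxZ eta (has_mean_mx_mull A^T has_mean_gx))).
apply: (eq_has_mean _ _
  (has_meanD (has_mean_dotv u.1 h1) (has_mean_dotv u.2 h2))).
  by move=> w; rewrite /dotp /seg_noise /= scaleN1r.
by rewrite !mulmx0 !scaler0 subr0 addr0 !scaler0 ![dotv _ 0]dotvC !dot0v addr0.
Qed.

Lemma integral_shift_seg_noise A u :
  (\int[Q]_w (sqn (u + seg_noise eta A (gxi (xi w))))%:E =
   (sqn u)%:E + \int[Q]_w (sqn (seg_noise eta A (gxi (xi w))))%:E)%E.
Proof.
have [If Ef] := has_meanD (has_mean_cst (sqn u))
  (has_meanZ 2 (has_mean_seg_noise A u)).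
rewrite mulr0 addr0 in Ef.
under eq_integral do rewrite sqnD EFinD.
by rewrite integralD ?Ef //; exact: integrable_sqn_seg_noise.
Qed.

Lemma measurable_seg_noise_pair :
  measurable_state (fun bg : borelType 'M[R]_(n, m) * borelType (state R n m) =>
    seg_noise eta bg.1 bg.2).
Proof.
apply: measurable_seg_noise.
  exact: (measurable_mx_comp measurable_fst (borel_measurable_mx (q := m))).
exact: (measurable_state_comp measurable_snd borel_measurable_state).
Qed.

Lemma independent_Bxi_gxi A C : @measurable _ (borelType 'M[R]_(n, m)) A ->
  @measurable _ (borelType (state R n m)) C ->
  Q (((fun w => Bxi (xi w)) @^-1` A) `&` ((fun w => gxi (xi w)) @^-1` C)) =
  (Q ((fun w => Bxi (xi w)) @^-1` A) * Q ((fun w => gxi (xi w)) @^-1` C))%E.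
Proof. exact: (A2_indep A2). Qed.

(** The sampled matrix and the sampled noise are independent and the noise is
centred: freezing the matrix kills the cross term. *)
Lemma integral_add_seg_noise (u : borelType 'M[R]_(n, m) -> state R n m) :
  measurable_state u ->
  (\int[Q]_w (sqn (u (Bxi (xi w)) + seg_noise eta (Bxi (xi w)) (gxi (xi w))))%:E =
   \int[Q]_w (sqn (u (Bxi (xi w))))%:E +
   \int[Q]_w (sqn (seg_noise eta (Bxi (xi w)) (gxi (xi w))))%:E)%E.
Proof.
move=> mu.
pose XB := fun w => (Bxi (xi w) : borelType 'M[R]_(n, m)).
pose XG := fun w => (gxi (xi w) : borelType (state R n m)).
have mN := measurable_sqn measurable_seg_noise_pair.
pose FN (bg : borelType 'M[R]_(n, m) * borelType (state R n m)) :=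
  (sqn (seg_noise eta bg.1 bg.2))%:E.
pose F (bg : borelType 'M[R]_(n, m) * borelType (state R n m)) :=
  (sqn (u bg.1 + seg_noise eta bg.1 bg.2))%:E.
have mFN : measurable_fun setT FN by apply/measurable_EFinP.
have mF : measurable_fun setT F.
  apply/measurable_EFinP; apply: measurable_sqn; apply: measurable_stateD.
    exact: (measurable_state_comp measurable_fst mu).
  exact: measurable_seg_noise_pair.
have FN0 x : (0 <= FN x)%E by rewrite lee_fin sqn_ge0.
have F0 x : (0 <= F x)%E by rewrite lee_fin sqn_ge0.
have mXB := Bxi_measurable rxi; have mXG := gxi_measurable rxi.
have EF := ge0_integral_independent mXB mXG independent_Bxi_gxi mF F0.
have EFN := ge0_integral_independent mXB mXG independent_Bxi_gxi mFN FN0.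
apply: (etrans EF); rewrite [X in _ = (_ + X)%E](EFN : _ = _).
transitivity (\int[Q]_w ((sqn (u (XB w)))%:E +
    \int[Q]_w' FN (XB w, XG w'))%E)%E.
  apply: eq_integral => w _.
  exact: (integral_shift_seg_noise (Bxi (xi w)) (u (Bxi (xi w)))).
rewrite ge0_integralD //.
- by move=> w _; rewrite lee_fin sqn_ge0.
- apply/measurable_EFinP; apply: measurable_sqn.
  exact: (measurable_state_comp mXB mu).
- by move=> w _; apply: integral_ge0 => w' _; exact: FN0.
- exact: measurable_partial_integral.
Qed.

(** Now the noise is frozen and the matrix is averaged: the excess over
[eta ^+ 2 * sg ^+ 2] is a quadratic form in the second moments of the matrix,
of which the step size leaves at most one half. *)
Lemma integral_sqn_seg_noise_le :
  (\int[Q]_w (sqn (seg_noise eta (Bxi (xi w)) (gxi (xi w))))%:E <=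
   (3 / 2 * eta ^+ 2 * sg ^+ 2)%:E)%E.
Proof.
pose XB := fun w => (Bxi (xi w) : borelType 'M[R]_(n, m)).
pose XG := fun w => (gxi (xi w) : borelType (state R n m)).
pose F (gb : borelType (state R n m) * borelType 'M[R]_(n, m)) :=
  (sqn (seg_noise eta gb.2 gb.1))%:E.
have mF : measurable_fun setT F.
  apply/measurable_EFinP; apply: measurable_sqn; apply: measurable_seg_noise.
    exact: (measurable_mx_comp measurable_snd (borel_measurable_mx (q := m))).
  exact: (measurable_state_comp measurable_fst borel_measurable_state).
have F0 x : (0 <= F x)%E by rewrite lee_fin sqn_ge0.
have indep A C : @measurable _ (borelType (state R n m)) A ->
    @measurable _ (borelType 'M[R]_(n, m)) C ->
    Q ((XG @^-1` A) `&` (XB @^-1` C)) = (Q (XG @^-1` A) * Q (XB @^-1` C))%E.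
  by move=> mA mC; rewrite setIC muleC; exact: independent_Bxi_gxi.
have EF := ge0_integral_independent (gxi_measurable rxi) (Bxi_measurable rxi)
  indep mF F0.
rewrite [leLHS](EF : _ = _).
have inner w : (\int[Q]_w' F (XG w, XB w') <=
    (3 / 2 * eta ^+ 2)%:E * (sqn (gxi (xi w)))%:E)%E.
  set g := gxi (xi w).
  have [_ E] := has_meanZ (eta ^+ 2) (has_meanD (has_mean_cst (sqn g))
    (has_meanZ (eta ^+ 2) (has_meanD
      (has_mean_quad g.1 g.1 (has_mean_mx_Emx (A1_intM A1)))
      (has_mean_quad g.2 g.2 (has_mean_mx_Emx (A1_intMh A1)))))).
  have -> : (\int[Q]_w' F (XG w, XB w') = (eta ^+ 2 * (sqn g + eta ^+ 2 *
      (dotv g.1 (meanM Q xi *m g.1) + dotv g.2 (meanMh Q xi *m g.2))))%:E)%E.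
    by rewrite -[RHS]E; apply: eq_integral => w' _; rewrite /F sqn_seg_noise.
  rewrite -EFinM lee_fin -[leRHS]mulrA [leRHS]mulrCA ler_wpM2l ?sqr_ge0 //.
  have := etaM_le g.1; have := etaMh_le g.2; rewrite /dotp mulrDr => h1 h2.
  rewrite /meanM /meanMh in h1 h2; lra.
apply: (@le_trans _ _ (\int[Q]_w
    ((3 / 2 * eta ^+ 2)%:E * (sqn (gxi (xi w)))%:E))%E).
  apply: ge0_le_integral => //.
  - by move=> w _; apply: integral_ge0 => w' _; exact: F0.
  - exact: (measurable_partial_integral Q (gxi_measurable rxi)
      (Bxi_measurable rxi) mF F0).
  - apply: measurable_funeM; apply/measurable_EFinP; apply: measurable_sqn.
    exact: measurable_state_gxi.
  - by move=> w _; exact: inner.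
rewrite integralZl //; last exact: integrable_sqn_gxi.
rewrite [leRHS]EFinM lee_wpmul2l ?integral_sqn_gxi_le //.
by rewrite lee_fin mulr_ge0 // sqr_ge0.
Qed.

End noise.


Lemma energy_arith (R : realType) (e mu x y Mx My M2x M2y : R) :
  0 <= e -> e * M2x <= 2^-1 * Mx -> e * M2y <= 2^-1 * My ->
  mu * x <= Mx -> mu * y <= My ->
  x + y + - e * (Mx + My) + e * e * (M2x + M2y) <= (1 - e * mu / 2) * (x + y).
Proof.
move=> e0 /(ler_wpM2l e0) h1 /(ler_wpM2l e0) h2.
by move=> /(ler_wpM2l e0) h3 /(ler_wpM2l e0) h4; lra.
Qed.

Lemma deviation_arith (R : realType) (eta s s2 x y Vx Vy Wx Wy : R) :
  Vx <= s * x -> Vy <= s * y -> Wx <= s2 * x -> Wy <= s2 * y ->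
  2 * eta ^+ 2 * (Vx + Vy) + 2 * eta ^+ 4 * (Wx + Wy) <=
  2 * eta ^+ 2 * (s + eta ^+ 2 * s2) * (x + y).
Proof.
have e2 := sqr_ge0 eta; have := mulr_ge0 e2 e2.
rewrite (_ : eta ^+ 4 = eta ^+ 2 * eta ^+ 2); last by ring.
move=> e4 /(ler_wpM2l e2) h1 /(ler_wpM2l e2) h2.
by move=> /(ler_wpM2l e4) h3 /(ler_wpM2l e4) h4; lra.
Qed.

Lemma coercive_arith (R : realType) (eta s r lmin alpha x y a b ca cb pa : R) :
  0 <= eta -> 0 <= s -> 0 <= r -> cb <= r * x * (s * y) ->
  - pa <= ca -> pa <= r * y * (s * x) ->
  2 * eta * s * r <= alpha * lmin ->
  lmin * x ^+ 2 <= b ^+ 2 -> lmin * y ^+ 2 <= a ^+ 2 ->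
  (1 - alpha) * lmin * (x ^+ 2 + y ^+ 2) <=
  a ^+ 2 + b ^+ 2 + 2 * (eta * (ca - cb)).
Proof.
move=> eta0 s0 r0 hcb hca hpa small hx hy.
have h1 := ler_wpM2r (addr_ge0 (sqr_ge0 x) (sqr_ge0 y)) small.
have h2 : - (2 * r * s * (x * y)) <= ca - cb by lra.
have h3 := ler_wpM2l eta0 h2.
have sr : 0 <= 2 * eta * s * r by rewrite !mulr_ge0.
have h4 := mulr_ge0 sr (sqr_ge0 (x - y)).
lra.
Qed.

Section steps.
Context {R : realType} d {S : measurableType d} (Q : probability S R)
  {n m : nat} (xi : S -> sample R n m) (sB sB2 sg eta mu : R).
Hypothesis rxi : random_element xi.
Hypothesis A1 : assumption_A1 Q xi sB sB2.
Hypothesis A2 : assumption_A2 Q xi sg.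

Let B := meanB Q xi.
Let M := meanM Q xi.
Let Mh := meanMh Q xi.
Let M2 := Emx Q (fun w => Mxi (xi w) *m Mxi (xi w)).
Let Mh2 := Emx Q (fun w => Mhxi (xi w) *m Mhxi (xi w)).
Let hB : has_mean_mx Q (fun w => Bxi (xi w)) B := has_mean_mx_Emx (A1_intB A1).
Let hM : has_mean_mx Q (fun w => Mxi (xi w)) M := has_mean_mx_Emx (A1_intM A1).
Let hMh : has_mean_mx Q (fun w => Mhxi (xi w)) Mh :=
  has_mean_mx_Emx (A1_intMh A1).
Let hM2 := has_mean_mx_Emx (A1_intM2 A1).
Let hMh2 := has_mean_mx_Emx (A1_intMh2 A1).

Hypothesis etaM_le : forall x,
  eta ^+ 2 * dotv x (M *m x) <= 2^-1 * dotv x x.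
Hypothesis etaMh_le : forall y,
  eta ^+ 2 * dotv y (Mh *m y) <= 2^-1 * dotv y y.
Hypothesis etaM2_le : forall x,
  eta ^+ 2 * dotv x (M2 *m x) <= 2^-1 * dotv x (M *m x).
Hypothesis etaMh2_le : forall y,
  eta ^+ 2 * dotv y (Mh2 *m y) <= 2^-1 * dotv y (Mh *m y).
Hypothesis mu_le : forall x, mu * dotv x x <= dotv x (M *m x).
Hypothesis muh_le : forall y, mu * dotv y y <= dotv y (Mh *m y).

(** The contribution of the fourth moments is at most half of the decrease that
the second moments produce. *)
Lemma seg_step_energy z :
  (\int[Q]_w (sqn (seg_step eta (xi w) z))%:E <=
   ((1 - eta ^+ 2 * mu / 2) * sqn z + 3 / 2 * eta ^+ 2 * sg ^+ 2)%:E)%E.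
Proof.
under eq_integral do rewrite seg_stepE.
have mu0 : measurable_state (fun b : borelType 'M[R]_(n, m) => det_step eta b z).
  apply: measurable_det_step; first exact: borel_measurable_mx.
  exact: measurable_state_cst.
rewrite [leLHS](integral_add_seg_noise eta rxi A2 mu0 : _ = _).
rewrite EFinD; apply: leeD;
  last exact: (integral_sqn_seg_noise_le rxi A1 A2 etaM_le etaMh_le).
have [_ E] := has_meanD (has_meanD (has_mean_cst (sqn z))
  (has_meanZ (- eta ^+ 2)
    (has_meanD (has_mean_quad z.1 z.1 hM) (has_mean_quad z.2 z.2 hMh))))
  (has_meanZ (eta ^+ 4)
    (has_meanD (has_mean_quad z.1 z.1 hM2) (has_mean_quad z.2 z.2 hMh2))).
rewrite [leLHS](_ : _ = \int[Q]_w (sqn z +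
    - eta ^+ 2 * (dotv z.1 (Mxi (xi w) *m z.1) + dotv z.2 (Mhxi (xi w) *m z.2))
  + eta ^+ 4 * (dotv z.1 (Mxi (xi w) *m Mxi (xi w) *m z.1)
    + dotv z.2 (Mhxi (xi w) *m Mhxi (xi w) *m z.2)))%:E)%E; last first.
  by apply: eq_integral => w _; rewrite sqn_det_step mulNr.
rewrite [leLHS](E : _ = _) lee_fin -/M2 -/Mh2.
rewrite (_ : eta ^+ 4 = eta ^+ 2 * eta ^+ 2); last by ring.
rewrite /dotp; apply: energy_arith; [exact: sqr_ge0 | exact: etaM2_le |
  exact: etaMh2_le | exact: mu_le | exact: muh_le].
Qed.

Definition mean_step (z : state R n m) : state R n m :=
  (z.1 - eta *: (B *m z.2) - eta ^+ 2 *: (M *m z.1),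
   z.2 + eta *: (B^T *m z.1) - eta ^+ 2 *: (Mh *m z.2)).

Let dev b z : state R n m :=
  (- eta *: ((b - B) *m z.2) - eta ^+ 2 *: ((b *m b^T - M) *m z.1),
   eta *: ((b - B)^T *m z.1) - eta ^+ 2 *: ((b^T *m b - Mh) *m z.2)).

Let devE b z : det_step eta b z - mean_step z = dev b z.
Proof.
case: z => x y; rewrite /det_step /mean_step /dev /=.
have -> : (b - B)^T = b^T - B^T by rewrite linearB.
congr pair => /=; rewrite !mulmxBl;
  by apply/matrixP => i j; rewrite ![in LHS]mxE ![in RHS]mxE; ring.
Qed.

Lemma meanM_sym : M^T = M.
Proof.
rewrite -[RHS](Emx_has_mean_mx hM) -(Emx_has_mean_mx (has_mean_mx_tr hM)).
by congr Emx; apply/funext => w; rewrite /Mxi trmx_mul trmxK.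
Qed.

Lemma meanMh_sym : Mh^T = Mh.
Proof.
rewrite -[RHS](Emx_has_mean_mx hMh) -(Emx_has_mean_mx (has_mean_mx_tr hMh)).
by congr Emx; apply/funext => w; rewrite /Mhxi trmx_mul trmxK.
Qed.

Let V := Emx Q (fun w => (Bxi (xi w) - B) *m (Bxi (xi w) - B)^T).
Let Vh := Emx Q (fun w => (Bxi (xi w) - B)^T *m (Bxi (xi w) - B)).
Let W := Emx Q (fun w => (Mxi (xi w) - M) *m (Mxi (xi w) - M)).
Let Wh := Emx Q (fun w => (Mhxi (xi w) - Mh) *m (Mhxi (xi w) - Mh)).

Let hVE : has_mean_mx Q (fun w => (Bxi (xi w) - B) *m (Bxi (xi w) - B)^T)
  (M - B *m B^T).
Proof. exact: has_mean_mx_cov hB hM. Qed.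

Let hVhE : has_mean_mx Q (fun w => (Bxi (xi w) - B)^T *m (Bxi (xi w) - B))
  (Mh - B^T *m B).
Proof.
have hMh' : has_mean_mx Q (fun w => (Bxi (xi w))^T *m (Bxi (xi w))^T^T) Mh.
  by under eq_fun do rewrite trmxK.
have := has_mean_mx_cov (has_mean_mx_tr hB) hMh'.
rewrite trmxK; congr has_mean_mx; apply/funext => w.
have -> : (Bxi (xi w))^T - B^T = (Bxi (xi w) - B)^T by rewrite linearB.
by rewrite trmxK.
Qed.

Lemma meanM_decomp : M = B *m B^T + V.
Proof. by rewrite /V (Emx_has_mean_mx hVE) addrC subrK. Qed.

Lemma meanMh_decomp : Mh = B^T *m B + Vh.
Proof. by rewrite /Vh (Emx_has_mean_mx hVhE) addrC subrK. Qed.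

Lemma sqr_meanB_le x : dotv (B^T *m x) (B^T *m x) <= dotv x (M *m x).
Proof.
have := le_has_mean (has_mean_cst 0) (has_mean_quad x x hVE).
rewrite mulmxBl dotvBr subr_ge0 [dotv (B^T *m x) _]dotv_mull trmxK mulmxA.
by apply=> w; rewrite -mulmxA dotv_mulr; exact: dotv_ge0.
Qed.

Let hV : has_mean_mx Q (fun w => (Bxi (xi w) - B) *m (Bxi (xi w) - B)^T) V.
Proof. by rewrite /V (Emx_has_mean_mx hVE). Qed.

Let hVh : has_mean_mx Q (fun w => (Bxi (xi w) - B)^T *m (Bxi (xi w) - B)) Vh.
Proof. by rewrite /Vh (Emx_has_mean_mx hVhE). Qed.

Let hW : has_mean_mx Q (fun w => (Mxi (xi w) - M) *m (Mxi (xi w) - M)) W.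
Proof.
have hM2' : has_mean_mx Q (fun w => Mxi (xi w) *m (Mxi (xi w))^T) M2.
  by under eq_fun do rewrite {2}/Mxi trmx_mul trmxK.
have := has_mean_mx_cov hM hM2'.
rewrite (_ : (fun w => _) = fun w => (Mxi (xi w) - M) *m (Mxi (xi w) - M)).
  by move=> h; rewrite /W (Emx_has_mean_mx h).
apply/funext => w; congr (_ *m _).
by rewrite linearB /= meanM_sym /Mxi trmx_mul trmxK.
Qed.

Let hWh : has_mean_mx Q (fun w => (Mhxi (xi w) - Mh) *m (Mhxi (xi w) - Mh)) Wh.
Proof.
have hM2' : has_mean_mx Q (fun w => Mhxi (xi w) *m (Mhxi (xi w))^T) Mh2.
  by under eq_fun do rewrite {2}/Mhxi trmx_mul trmxK.
have := has_mean_mx_cov hMh hM2'.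
rewrite (_ : (fun w => _) = fun w => (Mhxi (xi w) - Mh) *m (Mhxi (xi w) - Mh)).
  by move=> h; rewrite /Wh (Emx_has_mean_mx h).
apply/funext => w; congr (_ *m _).
by rewrite linearB /= meanMh_sym /Mhxi trmx_mul trmxK.
Qed.

Let hdev z z0 : has_mean Q (fun w => dotp z0 (dev (Bxi (xi w)) z)) 0.
Proof.
have h1 := has_mean_mxB
  (has_mean_mxZ (- eta) (has_mean_mx_mulr z.2 (has_mean_mxB hB (has_mean_mx_cst B))))
  (has_mean_mxZ (eta ^+ 2) (has_mean_mx_mulr z.1 (has_mean_mxB hM (has_mean_mx_cst M)))).
have h2 := has_mean_mxB
  (has_mean_mxZ eta (has_mean_mx_mulr z.1
    (has_mean_mx_tr (has_mean_mxB hB (has_mean_mx_cst B)))))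
  (has_mean_mxZ (eta ^+ 2) (has_mean_mx_mulr z.2 (has_mean_mxB hMh (has_mean_mx_cst Mh)))).
apply: (eq_has_mean _ _
  (has_meanD (has_mean_dotv z0.1 h1) (has_mean_dotv z0.2 h2))) => //.
by rewrite !subrr trmx0 !mul0mx !scaler0 !subr0 !(dotvC _ 0) !dot0v addr0.
Qed.

Let dotv_sqrD p (u v : 'cV[R]_p) :
  dotv (u + v) (u + v) <= 2 * dotv u u + 2 * dotv v v.
Proof.
have := dotv_ge0 (u - v).
by rewrite !(dotvDl, dotvNl) !(dotvDr, dotvNr) (dotvC v u); lra.
Qed.

Let sqn_dev_le b z : sqn (dev b z) <=
  2 * eta ^+ 2 * (dotv z.1 ((b - B) *m (b - B)^T *m z.1)
                + dotv z.2 ((b - B)^T *m (b - B) *m z.2))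
  + 2 * eta ^+ 4 * (dotv z.1 ((b *m b^T - M) *m (b *m b^T - M) *m z.1)
                  + dotv z.2 ((b^T *m b - Mh) *m (b^T *m b - Mh) *m z.2)).
Proof.
have sM : (b *m b^T - M)^T = b *m b^T - M.
  by rewrite linearB /= trmx_mul trmxK meanM_sym.
have sMh : (b^T *m b - Mh)^T = b^T *m b - Mh.
  by rewrite linearB /= trmx_mul trmxK meanMh_sym.
case: z => x y; rewrite /dotp /dev /=.
apply: (le_trans (lerD (dotv_sqrD _ _) (dotv_sqrD _ _))).
rewrite !(dotvNl, dotvNr, dotvZl, dotvZr).
have quad p q (A : 'M[R]_(p, q)) v : dotv (A *m v) (A *m v) = dotv v (A^T *m A *m v).
  by rewrite dotv_mull mulmxA.
rewrite !quad trmxK sM sMh.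
set a1 := dotv _ _; set a2 := dotv _ _; set a3 := dotv _ _; set a4 := dotv _ _.
by rewrite le_eqVlt; apply/orP; left; apply/eqP; ring.
Qed.

(** The deviation of a step from its mean has mean zero, so that adding it to a
fixed vector [z0] adds its energy.  This is the orthogonality of martingale
increments. *)
Lemma seg_step_deviation z0 z :
  (\int[Q]_w (sqn (z0 + (seg_step eta (xi w) z - mean_step z)))%:E <=
   (sqn z0 + 2 * eta ^+ 2 * (sB ^+ 2 + eta ^+ 2 * sB2 ^+ 2) * sqn z
    + 3 / 2 * eta ^+ 2 * sg ^+ 2)%:E)%E.
Proof.
pose u (b : borelType 'M[R]_(n, m)) := z0 + (det_step eta b z - mean_step z).
have mu0 : measurable_state u.
  apply: measurable_stateD; first exact: measurable_state_cst.
  apply: measurable_stateB; last exact: measurable_state_cst.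
  apply: measurable_det_step; first exact: borel_measurable_mx.
  exact: measurable_state_cst.
rewrite [leLHS](_ : _ = \int[Q]_w (sqn (u (Bxi (xi w)) +
    seg_noise eta (Bxi (xi w)) (gxi (xi w))))%:E)%E; last first.
  apply: eq_integral => w _; rewrite seg_stepE /u -[in RHS]addrA.
  by rewrite [det_step _ _ _ + _ - _]addrAC.
rewrite [leLHS](integral_add_seg_noise eta rxi A2 mu0 : _ = _).
rewrite EFinD; apply: leeD;
  last exact: (integral_sqn_seg_noise_le rxi A1 A2 etaM_le etaMh_le).
have [IE E] := has_meanD (has_meanD (has_mean_cst (sqn z0))
    (has_meanZ 2 (hdev z z0)))
  (has_meanD
    (has_meanZ (2 * eta ^+ 2)
      (has_meanD (has_mean_quad z.1 z.1 hV) (has_mean_quad z.2 z.2 hVh)))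
    (has_meanZ (2 * eta ^+ 4)
      (has_meanD (has_mean_quad z.1 z.1 hW) (has_mean_quad z.2 z.2 hWh)))).
apply: (@le_trans _ _ (\int[Q]_w (sqn z0 + 2 * dotp z0 (dev (Bxi (xi w)) z)
  + (2 * eta ^+ 2 * (dotv z.1 ((Bxi (xi w) - B) *m (Bxi (xi w) - B)^T *m z.1)
                + dotv z.2 ((Bxi (xi w) - B)^T *m (Bxi (xi w) - B) *m z.2))
  + 2 * eta ^+ 4 * (dotv z.1 ((Mxi (xi w) - M) *m (Mxi (xi w) - M) *m z.1)
                  + dotv z.2 ((Mhxi (xi w) - Mh) *m (Mhxi (xi w) - Mh) *m z.2))))%:E)%E).
  apply: ge0_le_integral => //.
  - by move=> w _; rewrite lee_fin sqn_ge0.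
  - apply/measurable_EFinP; apply: measurable_sqn.
    exact: (measurable_state_comp (Bxi_measurable rxi) mu0).
  - by case/integrableP: IE.
  - move=> w _; rewrite lee_fin /u devE sqnD lerD2l; exact: sqn_dev_le.
rewrite [leLHS](E : _ = _) lee_fin mulr0 addr0 lerD2l.
have q1 := dotv_opnorm_le z.1 (A1_varBr A1).
have q2 := dotv_opnorm_le z.2 (A1_varBl A1).
have q3 := dotv_opnorm_le z.1 (A1_varM A1).
have q4 := dotv_opnorm_le z.2 (A1_varMh A1).
exact: (deviation_arith eta q1 q2 q3 q4).
Qed.

(** The skew coupling and its square are orthogonal, so that only the noise part [V]
of [M] can make the two components of the displacement interfere; the second
bound on the step size limits this effect. *)
Lemma mean_step_coercive alpha lmin lmax z :
  0 <= eta -> 0 <= lmax ->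
  (forall x, lmin * dotv x x <= dotv (B^T *m x) (B^T *m x)) ->
  (forall y, lmin * dotv y y <= dotv (B *m y) (B *m y)) ->
  (forall x, dotv (B^T *m x) (B^T *m x) <= lmax * dotv x x) ->
  (forall y, dotv (B *m y) (B *m y) <= lmax * dotv y y) ->
  2 * eta * sB ^+ 2 * Num.sqrt lmax <= alpha * lmin ->
  eta ^+ 2 * ((1 - alpha) * lmin) * sqn z <= sqn (z - mean_step z).
Proof.
case: z => x y eta0 lmax0 minx miny maxx maxy small.
set a := B *m y; set b := B^T *m x.
have -> : (x, y) - mean_step (x, y) =
    eta *: ((a, - b) + eta *: (M *m x, Mh *m y)).
  congr pair; rewrite /= -/a -/b; apply/matrixP => i j; rewrite !mxE; ring.
rewrite sqnZ -mulrA ler_wpM2l ?sqr_ge0 // sqnD.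
rewrite -[leLHS]addr0; apply: lerD; last exact: sqn_ge0.
have enorm_le p q (A : 'M[R]_(p, q)) v :
    (forall u, dotv (A *m u) (A *m u) <= lmax * dotv u u) ->
    enorm (A *m v) <= Num.sqrt lmax * enorm v.
  move=> /(_ v) h; rewrite !enorm_dotv -sqrtrM // ler_sqrt //.
  by rewrite mulr_ge0 ?dotv_ge0.
have ax : enorm a <= Num.sqrt lmax * enorm y by exact: enorm_le.
have bx : enorm b <= Num.sqrt lmax * enorm x by exact: enorm_le.
have Vx : enorm (V *m x) <= sB ^+ 2 * enorm x.
  by apply: (le_trans (enorm_mul_le _ _)); rewrite ler_wpM2r ?enorm_ge0 ?(A1_varBr A1).
have Vy : enorm (Vh *m y) <= sB ^+ 2 * enorm y.
  by apply: (le_trans (enorm_mul_le _ _)); rewrite ler_wpM2r ?enorm_ge0 ?(A1_varBl A1).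
have cross : dotp (a, - b) (M *m x, Mh *m y) =
    dotv a (V *m x) - dotv b (Vh *m y).
  rewrite /dotp /= meanM_decomp meanMh_decomp !mulmxDl !dotvDr !dotvNl.
  rewrite -!mulmxA -/a -/b.
  by rewrite (dotv_mulr B a b) (dotvC (B^T *m a)); ring.
rewrite dotpC dotpZl dotpC cross.
have c1 := ler_dotv_enorm a (V *m x); have c2 := ler_dotv_enorm b (Vh *m y).
have p1 := ler_pM (enorm_ge0 a) (enorm_ge0 (V *m x)) ax Vx.
have p2 := ler_pM (enorm_ge0 b) (enorm_ge0 (Vh *m y)) bx Vy.
have m1 := minx x; have m2 := miny y; rewrite -/a -/b in m1 m2.
rewrite ler_norml in c1; rewrite ler_norml in c2.
have {c1} /andP[c1 _] := c1; have {c2} /andP[_ c2] := c2.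
rewrite {1}/dotp /= {1}/dotp /= dotvNl dotvNr opprK.
rewrite -!sqr_enorm in m1 m2 *.
exact: (coercive_arith eta0 (sqr_ge0 sB) (sqrtr_ge0 lmax) (le_trans c2 p2)
  c1 p1 small m1 m2).
Qed.

End steps.

(** * The step size *)

Section second_moment.
Context {R : realType} d {S : measurableType d} (Q : probability S R) {p : nat}
  (X : S -> 'M[R]_p) (c : R).
Hypothesis symX : forall w, (X w)^T = X w.
Hypothesis IX : mx_integrable Q X.
Hypothesis IX2 : mx_integrable Q (fun w => X w *m X w).
Hypothesis c_gt0 : 0 < c.

Let M := Emx Q X.
Let M2 := Emx Q (fun w => X w *m X w).
Let rho := lambda_max (invsqrtmx M *m M2 *m invsqrtmx M).

Hypothesis c_le : forall x, c * dotv x x <= dotv x (M *m x).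

Lemma Emx_sym (Y : S -> 'M[R]_p) :
  mx_integrable Q Y -> (forall w, (Y w)^T = Y w) -> (Emx Q Y)^T = Emx Q Y.
Proof.
move=> /has_mean_mx_Emx/has_mean_mx_tr hY symY.
rewrite -(Emx_has_mean_mx hY); congr Emx; apply/funext => w; exact: symY.
Qed.

(** This is where the square roots in the definition of the step size are
used. *)
Lemma second_moment_le_rho x : dotv x (M2 *m x) <= rho * dotv x (M *m x).
Proof.
have symM : M^T = M by exact: Emx_sym.
apply: quad_le_lambda_max_invsqrtmx.
- apply/psdmxP; split => // v; apply: le_trans (c_le v).
  by rewrite mulr_ge0 ?dotv_ge0 // ltW.
- rewrite unitmxE unitfE; apply/negP => /det0P[v v0 vM].
  have := c_le v^T; rewrite -[M]symM -trmx_mul vM trmx0 dotvC dot0v.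
  by rewrite leNgt mulr_gt0 ?dotv_gt0 ?trmx_eq0.
- by apply: Emx_sym => // w; rewrite trmx_mul !symX.
Qed.

Lemma sqr_mean_le_second_moment x :
  dotv (M *m x) (M *m x) <= dotv x (M2 *m x).
Proof.
have symM : M^T = M by exact: Emx_sym.
have hM2' : has_mean_mx Q (fun w => X w *m (X w)^T) M2.
  by under eq_fun do rewrite symX; exact: has_mean_mx_Emx.
have h := has_mean_quad x x (has_mean_mx_cov (has_mean_mx_Emx IX) hM2').
have := le_has_mean (has_mean_cst 0) h.
rewrite -/M symM mulmxBl dotvBr subr_ge0 [dotv (M *m x) _]dotv_mull symM mulmxA.
apply=> w; rewrite -mulmxA dotv_mulr; exact: dotv_ge0.
Qed.

(** The mean is at most [rho], since its square is at most the second moment. *)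
Lemma mean_le_rho x : dotv x (M *m x) <= rho * dotv x x.
Proof.
have [->|x0] := eqVneq x 0; first by rewrite mulmx0 dot0v mulr0.
have Mx : 0 < dotv x (M *m x).
  by apply: lt_le_trans (c_le x); rewrite mulr_gt0 ?dotv_gt0.
have := CauchySchwarz x (M *m x).
have h := le_trans (sqr_mean_le_second_moment x) (second_moment_le_rho x).
move=> /le_trans/(_ (ler_wpM2l (dotv_ge0 x) h)).
by rewrite expr2 mulrA ler_pM2r // mulrC.
Qed.

Lemma rho_gt0 : (0 < p)%N -> 0 < rho.
Proof.
move=> p0; have [x x0] : exists x : 'cV[R]_p, x != 0.
  exists (const_mx 1); apply/eqP => /matrixP /(_ (Ordinal p0) 0).
  by rewrite !mxE => /eqP; rewrite oner_eq0.
have dx : 0 < dotv x x by rewrite dotv_gt0.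
rewrite -(pmulr_lgt0 _ dx); apply: lt_le_trans (mean_le_rho x).
by apply: lt_le_trans (c_le x); rewrite mulr_gt0.
Qed.

End second_moment.

Section step_size.
Context {R : realType} d {S : measurableType d} (Q : probability S R)
  {n : nat} (xi : S -> sample R n n) (sB sB2 alpha : R).
Hypothesis A1 : assumption_A1 Q xi sB sB2.
Hypothesis unitB : meanB Q xi \in unitmx.
Hypothesis alpha01 : 0 < alpha < 1.

Let le_max_both (a b : R) : a <= Num.max a b /\ b <= Num.max a b.
Proof. by rewrite !le_max !lexx orbT. Qed.
Let ge_min_both (a b : R) : Num.min a b <= a /\ Num.min a b <= b.
Proof. by rewrite !ge_min !lexx orbT. Qed.

Let B := meanB Q xi.
Let M := meanM Q xi.
Let Mh := meanMh Q xi.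
Let mu := Num.min (lambda_min M) (lambda_min Mh).
Let eta := eta_hat Q xi sB alpha.
Let lmin := lambda_min (B *m B^T).
Let lmax := lambda_max (B^T *m B).

Lemma size_gt0 : (0 < n)%N.
Proof.
case: (posnP n) => // n0; have := A1_B_gt0 A1.
rewrite /lambda_max (_ : [set a | _] = set0) ?sup0 ?ltxx //.
apply/seteqP; split => // a /= /eigenvalueP[v _] /eqP; apply.
by apply/matrixP => i j; exfalso; case: j => j; rewrite n0.
Qed.

Lemma symMxi w : (Mxi (xi w))^T = Mxi (xi w).
Proof. by rewrite /Mxi trmx_mul trmxK. Qed.

Lemma symMhxi w : (Mhxi (xi w))^T = Mhxi (xi w).
Proof. by rewrite /Mhxi trmx_mul trmxK. Qed.

Lemma mu_gt0 : 0 < mu. Proof. exact: A1_M_gt0 A1. Qed.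

Lemma mu_le_M x : mu * dotv x x <= dotv x (M *m x).
Proof.
apply: le_trans (lambda_min_le _ (Emx_sym (A1_intM A1) symMxi)).
exact: (ler_wpM2r (dotv_ge0 x) (ge_min_both _ _).1).
Qed.

Lemma mu_le_Mh x : mu * dotv x x <= dotv x (Mh *m x).
Proof.
apply: le_trans (lambda_min_le _ (Emx_sym (A1_intMh A1) symMhxi)).
exact: (ler_wpM2r (dotv_ge0 x) (ge_min_both _ _).2).
Qed.

Lemma lmax_gt0 : 0 < lmax. Proof. exact: A1_B_gt0 A1. Qed.

Let lambdaE :
  lambda_min (B^T *m B) = lmin /\ lambda_max (B *m B^T) = lmax.
Proof.
rewrite /lmin /lmax /lambda_min /lambda_max.
by split; [congr inf | congr sup]; apply/seteqP; split => a /=;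
  rewrite eigenvalue_mulmx_tr.
Qed.

Let symBBt : (B *m B^T)^T = B *m B^T.
Proof. by rewrite trmx_mul trmxK. Qed.
Let symBtB : (B^T *m B)^T = B^T *m B.
Proof. by rewrite trmx_mul trmxK. Qed.

Lemma lmin_le_tr x : lmin * dotv x x <= dotv (B^T *m x) (B^T *m x).
Proof. by rewrite dotv_mull trmxK mulmxA; exact: lambda_min_le. Qed.

Lemma lmin_le y : lmin * dotv y y <= dotv (B *m y) (B *m y).
Proof. by rewrite dotv_mull mulmxA -lambdaE.1; exact: lambda_min_le. Qed.

Lemma lmax_ge_tr x : dotv (B^T *m x) (B^T *m x) <= lmax * dotv x x.
Proof. by rewrite dotv_mull trmxK mulmxA -lambdaE.2; exact: lambda_max_ge. Qed.

Lemma lmax_ge y : dotv (B *m y) (B *m y) <= lmax * dotv y y.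
Proof. by rewrite dotv_mull mulmxA; exact: lambda_max_ge. Qed.

Lemma lmin_gt0 : 0 < lmin.
Proof.
have n0 := size_gt0.
suff : forall p (C : 'M[R]_p), (0 < p)%N -> C \in unitmx ->
  0 < lambda_min (C *m C^T) by move/(_ _ B n0 unitB).
case=> // p C _ uC; apply: lambda_min_gt0; first by rewrite trmx_mul trmxK.
move=> u u0; rewrite -mulmxA dotv_mulr dotv_gt0.
apply: contra_neq u0 => Cu0.
by rewrite -[u](mulKmx (_ : C^T \in unitmx)) ?unitmx_tr // Cu0 mulmx0.
Qed.

Let rho_max_gt0 : 0 < Num.max (rho1 Q xi) (rho2 Q xi).
Proof.
rewrite lt_max; apply/orP; left; apply: (rho_gt0 symMxi (A1_intM A1)
  (A1_intM2 A1) mu_gt0 mu_le_M size_gt0).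
Qed.

Lemma eta_hat_le : eta <= etaM Q xi / Num.sqrt 2.
Proof. by rewrite /eta /eta_hat; case: ifP => // _; rewrite ge_min lexx. Qed.

Lemma eta_hat_gt0 : 0 < eta.
Proof.
have a0 : 0 < alpha by case/andP: alpha01.
have e0 : 0 < etaM Q xi / Num.sqrt 2.
  by rewrite /etaM divr_gt0 ?sqrtr_gt0 // divr_gt0 ?sqrtr_gt0.
rewrite /eta /eta_hat; case: eqVneq => // sB0.
rewrite lt_min e0 /= divr_gt0 //; first by rewrite mulr_gt0 // lmin_gt0.
rewrite mulr_gt0 ?sqrtr_gt0 ?lmax_gt0 // mulr_gt0 //.
by rewrite lt_def sqr_ge0 sqrf_eq0 sB0.
Qed.

Lemma eta_hat_rho : eta ^+ 2 * Num.max (rho1 Q xi) (rho2 Q xi) <= 2^-1.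
Proof.
rewrite -ler_pdivlMr //.
have -> : 2^-1 / Num.max (rho1 Q xi) (rho2 Q xi) = (etaM Q xi / Num.sqrt 2) ^+ 2.
  by rewrite /etaM div1r exprMn !exprVn !sqr_sqrtr ?ltW // mulrC.
by rewrite lerXn2r ?nnegrE ?eta_hat_le ?(ltW eta_hat_gt0) //
  (le_trans (ltW eta_hat_gt0) eta_hat_le).
Qed.

Lemma eta_hat_noise : 2 * eta * sB ^+ 2 * Num.sqrt lmax <= alpha * lmin.
Proof.
have a0 : 0 < alpha by case/andP: alpha01.
rewrite /eta /eta_hat; case: eqVneq => [->|sB0].
  by rewrite expr0n mulr0 mul0r mulr_ge0 // ltW // lmin_gt0.
have D0 : 0 < 2 * sB ^+ 2 * Num.sqrt lmax.
  rewrite mulr_gt0 ?sqrtr_gt0 ?lmax_gt0 // mulr_gt0 //.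
  by rewrite lt_def sqr_ge0 sqrf_eq0 sB0.
set e := Num.min _ _.
have : e <= alpha * lmin / (2 * sB ^+ 2 * Num.sqrt lmax).
  by rewrite /e ge_min lexx orbT.
by rewrite ler_pdivlMr // (_ : e * _ = 2 * e * sB ^+ 2 * Num.sqrt lmax) //; ring.
Qed.

Let eta_quad_le r a b : r <= Num.max (rho1 Q xi) (rho2 Q xi) ->
  0 <= b -> a <= r * b -> eta ^+ 2 * a <= 2^-1 * b.
Proof.
move=> rm b0 ab; apply: (le_trans (ler_wpM2l (sqr_ge0 _) ab)).
rewrite mulrA ler_wpM2r //; apply: le_trans eta_hat_rho.
by rewrite ler_wpM2l ?sqr_ge0.
Qed.

Let M_ge0 x : 0 <= dotv x (M *m x).
Proof. by apply: le_trans (mu_le_M x); rewrite mulr_ge0 ?dotv_ge0 // ltW // mu_gt0. Qed.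

Let Mh_ge0 x : 0 <= dotv x (Mh *m x).
Proof. by apply: le_trans (mu_le_Mh x); rewrite mulr_ge0 ?dotv_ge0 // ltW // mu_gt0. Qed.

Let rho1_le : rho1 Q xi <= Num.max (rho1 Q xi) (rho2 Q xi).
Proof. exact: (le_max_both _ _).1. Qed.
Let rho2_le : rho2 Q xi <= Num.max (rho1 Q xi) (rho2 Q xi).
Proof. exact: (le_max_both _ _).2. Qed.

Lemma eta_hat_M x : eta ^+ 2 * dotv x (M *m x) <= 2^-1 * dotv x x.
Proof.
apply: (eta_quad_le rho1_le (dotv_ge0 x)).
exact: (mean_le_rho symMxi (A1_intM A1) (A1_intM2 A1) mu_gt0 mu_le_M).
Qed.

Lemma eta_hat_Mh x : eta ^+ 2 * dotv x (Mh *m x) <= 2^-1 * dotv x x.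
Proof.
apply: (eta_quad_le rho2_le (dotv_ge0 x)).
exact: (mean_le_rho symMhxi (A1_intMh A1) (A1_intMh2 A1) mu_gt0 mu_le_Mh).
Qed.

Lemma eta_hat_M2 x : eta ^+ 2 *
  dotv x (Emx Q (fun w => Mxi (xi w) *m Mxi (xi w)) *m x) <=
  2^-1 * dotv x (M *m x).
Proof.
apply: (eta_quad_le rho1_le (M_ge0 x)).
exact: (second_moment_le_rho symMxi (A1_intM A1) (A1_intM2 A1) mu_gt0 mu_le_M).
Qed.

Lemma eta_hat_Mh2 x : eta ^+ 2 *
  dotv x (Emx Q (fun w => Mhxi (xi w) *m Mhxi (xi w)) *m x) <=
  2^-1 * dotv x (Mh *m x).
Proof.
apply: (eta_quad_le rho2_le (Mh_ge0 x)).
exact: (second_moment_le_rho symMhxi (A1_intMh A1) (A1_intMh2 A1) mu_gt0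
  mu_le_Mh).
Qed.

End step_size.

(** * Averages over a block of consecutive iterates *)

(** Monotonicity and linearity of the integral at once, with extended real
values on the left because inner integrals may a priori be infinite. *)
Lemma ge0_integral_le_lincomb (R : realType) d (T : measurableType d)
    (P : probability T R) (f : T -> \bar R) (g1 g2 g3 : T -> R)
    (a1 a2 a3 b r1 r2 r3 : R) :
  measurable_fun setT f -> (forall w, (0 <= f w)%E) ->
  measurable_fun setT g1 -> measurable_fun setT g2 -> measurable_fun setT g3 ->
  (forall w, 0 <= g1 w) -> (forall w, 0 <= g2 w) -> (forall w, 0 <= g3 w) ->
  0 <= a1 -> 0 <= a2 -> 0 <= a3 -> 0 <= b ->
  (forall w, (f w <= (a1 * g1 w + a2 * g2 w + a3 * g3 w + b)%:E)%E) ->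
  (\int[P]_w (g1 w)%:E <= r1%:E)%E -> (\int[P]_w (g2 w)%:E <= r2%:E)%E ->
  (\int[P]_w (g3 w)%:E <= r3%:E)%E ->
  (\int[P]_w f w <= (a1 * r1 + a2 * r2 + a3 * r3 + b)%:E)%E.
Proof.
move=> mf f0 m1 m2 m3 g1_ge0 g2_ge0 g3_ge0 a1_ge0 a2_ge0 a3_ge0 b0 fg h1 h2 h3.
have mZ (g : T -> R) a : measurable_fun setT g ->
    measurable_fun setT (fun w => (a * g w)%:E).
  move=> mg; apply/measurable_EFinP.
  by apply: (@measurable_funM _ _ _ _ (cst a) g) => //; exact: measurable_cst.
have Zle (g : T -> R) a r : measurable_fun setT g -> (forall w, 0 <= g w) ->
    0 <= a -> (\int[P]_w (g w)%:E <= r%:E)%E ->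
    (\int[P]_w (a * g w)%:E <= (a * r)%:E)%E.
  move=> mg g0 a0 h; under eq_integral do rewrite EFinM.
  rewrite ge0_integralZl_EFin //; first by rewrite EFinM lee_wpmul2l ?lee_fin.
    by move=> w _; rewrite lee_fin.
  exact/measurable_EFinP.
have p1 w : (0 <= (a1 * g1 w)%:E)%E by rewrite lee_fin mulr_ge0.
have p2 w : (0 <= (a2 * g2 w)%:E)%E by rewrite lee_fin mulr_ge0.
have p3 w : (0 <= (a3 * g3 w)%:E)%E by rewrite lee_fin mulr_ge0.
have n1 := mZ _ a1 m1; have n2 := mZ _ a2 m2; have n3 := mZ _ a3 m3.
have n12 := emeasurable_funD n1 n2; have n123 := emeasurable_funD n12 n3.
have nb : measurable_fun setT (fun _ : T => b%:E) by exact: measurable_cst.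
have p12 w : (0 <= (a1 * g1 w)%:E + (a2 * g2 w)%:E)%E by exact: adde_ge0.
have p123 w : (0 <= (a1 * g1 w)%:E + (a2 * g2 w)%:E + (a3 * g3 w)%:E)%E.
  exact: adde_ge0.
apply: (@le_trans _ _ (\int[P]_w ((a1 * g1 w)%:E + (a2 * g2 w)%:E
    + (a3 * g3 w)%:E + b%:E))%E).
  by apply: ge0_le_integral => //; exact: (emeasurable_funD n123 nb).
rewrite (ge0_integralD _ measurableT (fun w _ => p123 w) n123) //.
rewrite (ge0_integralD _ measurableT (fun w _ => p12 w) n12) //.
rewrite (ge0_integralD _ measurableT (fun w _ => p1 w) n1) //.
rewrite integral_cst //= probability_setT mule1 !EFinD.
by rewrite !leeD ?lexx ?Zle.
Qed.

(** The run without restarts. *)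
Fixpoint seg_traj (R : realType) n m (eta : R) (s : nat -> sample R n m)
    (z : state R n m) (k : nat) : state R n m :=
  if k is k'.+1 then seg_step eta (s k') (seg_traj eta s z k') else z.

Section block.
Context {R : realType} dS {S : measurableType dS} (Q : probability S R)
  dT {T : measurableType dT} (P : probability T R) {n m : nat}
  (xi : S -> sample R n m) (xis : nat -> T -> sample R n m).
Variables (eta D a c v lam : R).
Hypothesis rxi : random_element xi.
Hypothesis iid : iid_copies Q P xi xis.

Let mean := mean_step Q xi eta.

Hypothesis energy : forall z,
  (\int[Q]_w (sqn (seg_step eta (xi w) z))%:E <=
   ((1 - a) * sqn z + c)%:E)%E.
Hypothesis deviation : forall z0 z : state R n m,
  (\int[Q]_w (sqn (z0 + (seg_step eta (xi w) z - mean z)))%:E <=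
   (sqn z0 + v * sqn z + c)%:E)%E.
Hypothesis coercive : forall z, lam * sqn z <= sqn (z - mean z).
Hypotheses (a01 : 0 <= a <= 1) (c0 : 0 <= c) (v0 : 0 <= v) (lam0 : 0 <= lam).
Hypothesis cD : c <= a * D.

Lemma measurable_seg_step d (U : measurableType d)
    (X : U -> borelType (sample R n m)) (Z : U -> state R n m) :
  measurable_fun setT X -> measurable_state Z ->
  measurable_state (fun u => seg_step eta (X u) (Z u)).
Proof.
move=> mX mZ.
have mB : measurable_mx (fun u => Bxi (X u)).
  apply: (measurable_mx_comp mX) => i j; apply: continuous_borel_real => s.
  apply: (@continuous_comp _ _ _ fst (fun b : 'M[R]_(n, m) => b i j)).
    exact: (@cvg_fst _ _ (nbhs s.1) (nbhs s.2)).
  exact: coord_continuous.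
have mg : measurable_state (fun u => gxi (X u)).
  have mg' : measurable_fun setT
      (@gxi R n m : borelType (sample R n m) -> borelType (state R n m)).
    apply: continuous_borel => s.
    exact: (@cvg_snd _ _ (nbhs s.1) (nbhs s.2)).
  exact: (measurable_state_comp mX
    (measurable_state_comp mg' borel_measurable_state)).
under eq_fun do rewrite seg_stepE.
apply: measurable_stateD; first exact: measurable_det_step.
exact: measurable_seg_noise.
Qed.

Lemma measurable_mean_step d (U : measurableType d) (Z : U -> state R n m) :
  measurable_state Z -> measurable_state (fun u => mean (Z u)).
Proof.
move=> [m1 m2].
have mA p q (A : 'M[R]_(p, q)) (Y : U -> 'cV[R]_q) :
    measurable_mx Y -> measurable_mx (fun u => A *m Y u).
  by move=> mY; apply: measurable_mxM => //; exact: measurable_mx_cst.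
split=> /=.
  by apply: measurable_mxB; [apply: measurable_mxB => // | ];
    apply: measurable_mxZ; exact: mA.
by apply: measurable_mxB; [apply: measurable_mxD => // | ];
  apply: measurable_mxZ; exact: mA.
Qed.

Lemma mean_stepD z1 z2 : mean (z1 + z2) = mean z1 + mean z2.
Proof.
rewrite /mean /mean_step; congr pair; rewrite /= !mulmxDr !scalerDr;
  apply/matrixP => i j; rewrite ![in LHS]mxE ![in RHS]mxE; ring.
Qed.

Variables (t0 : nat) (Z0 : T -> state R n m).
Hypothesis mZ0 : measurable_state (Z0 : pastType xis t0 -> state R n m).
Hypothesis EZ0 : (\int[P]_w (sqn (Z0 w))%:E <= D%:E)%E.

Let Z (k : nat) (w : T) := seg_traj eta (fun i => xis (t0 + i) w) (Z0 w) k.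
Let Dev (k : nat) (w : T) := \sum_(0 <= i < k) (Z i.+1 w - mean (Z i w)).

Let rxis := let: And3 r _ _ := iid in r.
Let law := let: And3 _ l _ := iid in l.
Let indep := let: And3 _ _ i := iid in i.

Lemma past_stateW (Y : T -> state R n m) t t' : (t <= t')%N ->
  measurable_state (Y : pastType xis t -> state R n m) ->
  measurable_state (Y : pastType xis t' -> state R n m).
Proof.
move=> tt' [m1 m2]; split=> i j.
  exact: (past_funW tt' (m1 i j)).
exact: (past_funW tt' (m2 i j)).
Qed.

Lemma past_state_measurable (Y : T -> state R n m) t :
  measurable_state (Y : pastType xis t -> state R n m) -> measurable_state Y.
Proof.
move=> [m1 m2]; split=> i j _ A mA; apply: (past_measurable rxis (t := t)).
  exact: m1.
exact: m2.
Qed.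

Let mZ k : measurable_state (Z k : pastType xis (t0 + k) -> state R n m).
Proof.
elim: k => [|k IH]; first by rewrite addn0; exact: mZ0.
rewrite addnS; apply: measurable_seg_step.
  exact: past_sample_measurable.
exact: past_stateW IH.
Qed.

Let mDev k : measurable_state (Dev k : pastType xis (t0 + k) -> state R n m).
Proof.
elim: k => [|k IH].
  by rewrite /Dev; under eq_fun do rewrite big_nil; exact: measurable_state_cst.
rewrite /Dev; under eq_fun do rewrite big_nat_recr //=.
apply: measurable_stateD; first by rewrite addnS; exact: past_stateW IH.
apply: measurable_stateB; first exact: mZ.
by apply: measurable_mean_step; rewrite addnS; apply: past_stateW (mZ k).
Qed.

(** Both the energy and the deviation recursions are instances: a bound that
holds for deterministic points [z0] and [z] is integrated over random points
[Y] and [Y'] of the past. *)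
Let freeze k (Y Y' : T -> state R n m)
    (F : state R n m -> state R n m -> state R n m -> state R n m) r1 r2
    (b1 b2 : R) :
  measurable_state (Y : pastType xis (t0 + k) -> state R n m) ->
  measurable_state (Y' : pastType xis (t0 + k) -> state R n m) ->
  (forall d (U : measurableType d) (A B C : U -> state R n m),
    measurable_state A -> measurable_state B -> measurable_state C ->
    measurable_state (fun u => F (A u) (B u) (C u))) ->
  0 <= b1 -> 0 <= b2 ->
  (forall z0 z, (\int[Q]_s (sqn (F z0 z (seg_step eta (xi s) z)))%:E <=
    (b1 * sqn z0 + b2 * sqn z + c)%:E)%E) ->
  (\int[P]_w (sqn (Y w))%:E <= r1%:E)%E ->
  (\int[P]_w (sqn (Y' w))%:E <= r2%:E)%E ->
  (\int[P]_w (sqn (F (Y w) (Y' w) (seg_step eta (xis (t0 + k) w) (Y' w))))%:E <=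
    (b1 * r1 + b2 * r2 + c)%:E)%E.
Proof.
move=> mY mY' mF b1_ge0 b2_ge0 bound h1 h2.
pose G (z : pastType xis (t0 + k) * borelType (sample R n m)) :=
  (sqn (F (Y z.1) (Y' z.1) (seg_step eta z.2 (Y' z.1))))%:E.
have mG : measurable_fun setT G.
  have mY1 := measurable_state_comp measurable_fst mY.
  have mY2 := measurable_state_comp measurable_fst mY'.
  apply/measurable_EFinP; apply: measurable_sqn; apply: mF => //.
    exact: mY1.
    exact: mY2.
  by apply: measurable_seg_step; [exact: measurable_snd | exact: mY2].
have G0 z : (0 <= G z)%E by rewrite lee_fin sqn_ge0.
rewrite [leLHS](past_freeze rxis indep rxi (law (t0 + k)) mG G0 : _ = _).
have mI := measurable_partial_integral Q (past_id_measurable rxis (t := t0 + k))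
  (random_element_measurable rxi) mG G0.
have I0 w : (0 <= \int[Q]_s G (w, xi s))%E.
  by apply: integral_ge0 => s _; exact: G0.
have mYT := measurable_sqn (past_state_measurable mY).
have mYT' := measurable_sqn (past_state_measurable mY').
have Y_ge0 w : 0 <= sqn (Y w) by exact: sqn_ge0.
have Y'_ge0 w : 0 <= sqn (Y' w) by exact: sqn_ge0.
have fg w : (\int[Q]_s G (w, xi s) <= (b1 * sqn (Y w) + b2 * sqn (Y' w)
    + 0 * sqn (Y w) + c)%:E)%E.
  by rewrite mul0r addr0; exact: (bound (Y w) (Y' w)).
have H := ge0_integral_le_lincomb mI I0 mYT mYT' mYT Y_ge0 Y'_ge0 Y_ge0
  b1_ge0 b2_ge0 (lexx 0) c0 fg h1 h2 h1.
rewrite mul0r addr0 in H; exact: H.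
Qed.

(** [c / a] is the stationary level of the energy recursion. *)
Lemma block_energy k : (\int[P]_w (sqn (Z k w))%:E <= D%:E)%E.
Proof.
elim: k => [|k IH]; first exact: EZ0.
have bound (z0 z : state R n m) : (\int[Q]_s (sqn (seg_step eta (xi s) z))%:E <=
    (0 * sqn z0 + (1 - a) * sqn z + c)%:E)%E.
  by rewrite mul0r add0r; exact: energy.
have /andP[a0 a1] := a01.
have a1' : 0 <= 1 - a by rewrite subr_ge0.
have H := freeze (F := fun _ _ z => z) (mZ k) (mZ k)
  (fun _ _ _ _ _ _ _ h => h) (lexx 0) a1' bound IH IH.
apply: (le_trans H).
by rewrite lee_fin mul0r add0r mulrBl mul1r -[leRHS](subrK (a * D)) lerD2l.
Qed.

(** Each new deviation is orthogonal to the sum of the previous ones, which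
belongs to the past. *)
Lemma block_deviation k :
  (\int[P]_w (sqn (Dev k w))%:E <= (k%:R * (v * D + c))%:E)%E.
Proof.
elim: k => [|k IH].
  rewrite mul0r; under eq_integral do rewrite /Dev big_nil.
  by rewrite /dotp !dot0v addr0 integral0.
have bound z0 z : (\int[Q]_s (sqn (z0 + (seg_step eta (xi s) z - mean z)))%:E <=
    (1 * sqn z0 + v * sqn z + c)%:E)%E by rewrite mul1r; exact: deviation.
have mF d (U : measurableType d) (A B C : U -> state R n m) :
    measurable_state A -> measurable_state B -> measurable_state C ->
    measurable_state (fun u => A u + (C u - mean (B u))).
  move=> mA mB mC; apply: measurable_stateD => //.
  by apply: measurable_stateB => //; exact: measurable_mean_step.
have H := freeze (F := fun z0 z z' => z0 + (z' - mean z)) (mDev k) (mZ k) mF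
  ler01 v0 bound IH (block_energy k).
rewrite [leLHS](_ : _ = \int[P]_w (sqn (Dev k w + (seg_step eta
    (xis (t0 + k) w) (Z k w) - mean (Z k w))))%:E)%E; last first.
  by apply: eq_integral => w _; rewrite /Dev big_nat_recr.
apply: (le_trans H).
by rewrite lee_fin mul1r -natr1 mulrDl mul1r addrA.
Qed.

(** Summing [Z i.+1 = mean (Z i) + deviation] over the block, the mean
displacement of the sum telescopes. *)
Lemma block_telescope N w :
  \sum_(0 <= i < N) Z i w - mean (\sum_(0 <= i < N) Z i w) =
  Z 0 w - Z N w + Dev N w.
Proof.
elim: N => [|N IH].
  rewrite /Dev !big_nil subrr !sub0r addr0 /mean /mean_step /=.
  by rewrite !mulmx0 !scaler0 !subr0 addr0 oppr0.
rewrite /Dev !big_nat_recr //= mean_stepD -/(Dev N w) opprD addrACA IH.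
have swap (V : zmodType) (p q r s t : V) :
    p - q + r + (q - t) = p - s + (r + (s - t)).
  rewrite [LHS]addrA [p - q + r]addrAC subrK.
  by rewrite addrA [RHS]addrA [p - s + r]addrAC subrK.
exact: swap.
Qed.

Lemma block_sum_measurable N :
  measurable_state (fun w => \sum_(0 <= i < N) Z i w).
Proof.
elim: N => [|N IH].
  by under eq_fun do rewrite big_nil; exact: measurable_state_cst.
under eq_fun do rewrite big_nat_recr //=.
by apply: measurable_stateD => //; exact: past_state_measurable (mZ N).
Qed.

Lemma block_sum N :
  (\int[P]_w (lam * sqn (\sum_(0 <= i < N) Z i w)%R)%:E <=
   (12 * D + 3 / 2 * (N%:R * (v * D + c)))%:E)%E.
Proof.
have mT k := past_state_measurable (mZ k).
have m0 := measurable_sqn (mT 0); have mN := measurable_sqn (mT N).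
have mD := measurable_sqn (past_state_measurable (mDev N)).
have mf : measurable_fun setT
    (fun w => (lam * sqn (\sum_(0 <= i < N) Z i w)%R)%:E).
  apply/measurable_EFinP; apply: (@measurable_funM _ _ _ _ (cst lam)).
    exact: measurable_cst.
  exact: measurable_sqn (block_sum_measurable N).
have fg w : ((lam * sqn (\sum_(0 <= i < N) Z i w)%R)%:E <=
    (6 * sqn (Z 0 w) + 6 * sqn (Z N w) + 3 / 2 * sqn (Dev N w) + 0)%:E)%E.
  rewrite lee_fin addr0; apply: le_trans (coercive _) _.
  rewrite block_telescope.
  (* The weight 2 charges the end points more than the deviations; this is the
     balance that the shift by one in the epoch lengths requires. *)
  have h1 := sqnD_le (Z 0 w - Z N w) (Dev N w) (ltr0n R 2 : 0 < 2).
  have h2 := sqnD_le (Z 0 w) (- Z N w) (ltr01 : 0 < 1 :> R).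
  by rewrite sqnN in h2; apply: le_trans h1 _; lra.
have H := ge0_integral_le_lincomb mf _ m0 mN mD (fun w => sqn_ge0 _)
  (fun w => sqn_ge0 _) (fun w => sqn_ge0 _) (ler0n R 6) (ler0n R 6) _ (lexx 0) fg
  (block_energy 0) (block_energy N) (block_deviation N).
apply: le_trans (H _ _) _.
- by move=> w; rewrite lee_fin mulr_ge0 ?sqn_ge0.
- by rewrite divr_ge0.
by rewrite lee_fin; lra.
Qed.

End block.

(** * The restarts *)

Section restarts.
Context {R : realType} {n m : nat} (eta : R) (E : nat) (Kl : nat -> nat)
  (z0 : state R n m).
Hypothesis Kl_gt0 : forall j, (1 <= j <= E)%N -> (0 < Kl j)%N.

Lemma epoch_endS j : epoch_end Kl j.+1 = (epoch_end Kl j + Kl j.+1)%N.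
Proof. by rewrite /epoch_end big_nat_recr. Qed.

Lemma epoch_end0 : epoch_end Kl 0 = 0%N.
Proof. by rewrite /epoch_end big_geq. Qed.

Lemma epoch_end_mono i j : (i <= j)%N -> (epoch_end Kl i <= epoch_end Kl j)%N.
Proof.
move=> /subnK <-; elim: (j - i)%N => // k IH.
by rewrite addSn epoch_endS (leq_trans IH) // leq_addr.
Qed.

Lemma epoch_end_restart j : (1 <= j <= E)%N ->
  is_restart E Kl (epoch_end Kl j).
Proof.
move=> jE; apply/hasP; exists j => //.
by rewrite mem_iota add1n ltnS.
Qed.

Lemma not_restart_between j t : (j < E)%N ->
  (epoch_end Kl j < t)%N -> (t < epoch_end Kl j.+1)%N -> ~~ is_restart E Kl t.
Proof.
move=> jE jt tj; apply/hasP => -[i _ /eqP ti].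
have [ij|ji] := leqP i j; have := epoch_end_mono; last first.
  by move=> /(_ _ _ ji); rewrite -ti leqNgt tj.
by move=> /(_ _ _ ij); rewrite -ti leqNgt jt.
Qed.

Lemma not_restart_after t : (epoch_end Kl E < t)%N -> ~~ is_restart E Kl t.
Proof.
move=> Et; apply/hasP => -[i]; rewrite mem_iota add1n ltnS => /andP[_ iE] /eqP ti.
by have := epoch_end_mono iE; rewrite -ti leqNgt Et.
Qed.

Lemma not_restart0 : ~~ is_restart E Kl 0.
Proof.
apply/hasP => -[[|i]]; rewrite mem_iota add1n ltnS // => /andP[_ iE] /eqP/esym.
rewrite epoch_endS => /eqP; rewrite addn_eq0 => /andP[_].
by rewrite eqn0Ngt Kl_gt0.
Qed.

Variable s : nat -> sample R n m.

Let run := seg_run eta E Kl z0 s.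
Let iter := seg_iter eta E Kl z0 s.

Lemma seg_runS t :
  let st := rs_overwrite (is_restart E Kl t) (run t) in
  let z := seg_step eta (s t) (rs_iter st) in
  run t.+1 = RunState z (rs_sum st + z) (rs_len st).+1.
Proof. by []. Qed.

Lemma seg_run_epoch_start j : (j <= E)%N ->
  rs_overwrite (is_restart E Kl (epoch_end Kl j)) (run (epoch_end Kl j)) =
  RunState (iter (epoch_end Kl j)) 0 0.
Proof.
case: j => [|j] jE.
  by rewrite /iter /seg_iter epoch_end0 (negbTE not_restart0).
by rewrite /iter /seg_iter epoch_end_restart.
Qed.

Lemma seg_run_window t k :
  rs_overwrite (is_restart E Kl t) (run t) = RunState (iter t) 0 0 ->
  (forall i, (0 < i)%N -> (i < k.+1)%N -> ~~ is_restart E Kl (t + i)) ->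
  run (t + k.+1)%N =
  RunState (seg_traj eta (fun i => s (t + i)%N) (iter t) k.+1)
    (\sum_(1 <= i < k.+2) seg_traj eta (fun i => s (t + i)%N) (iter t) i) k.+1.
Proof.
move=> start; elim: k => [|k IH] norestart.
  by rewrite addn1 seg_runS start big_nat1 /= addn0 add0r.
rewrite addnS seg_runS IH; last first.
  by move=> i i0 ik; apply: norestart => //; exact: ltnW.
by rewrite (negbTE (norestart _ _ _)) // [in RHS]big_nat_recr.
Qed.

Lemma seg_traj_shift (z : state R n m) (r : nat -> sample R n m) k :
  seg_traj eta r z k.+1 =
  seg_traj eta (fun i => r i.+1) (seg_step eta (r 0) z) k.
Proof. by elim: k => //= k ->. Qed.

(** The average omits the point at which the epoch starts; it is the average
over a run without restarts that begins one step later. *)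
Lemma seg_hat_epoch j : (j < E)%N ->
  seg_hat eta E Kl z0 s (epoch_end Kl j.+1) =
  (Kl j.+1)%:R^-1 *: \sum_(0 <= i < Kl j.+1)
    seg_traj eta (fun i => s ((epoch_end Kl j).+1 + i)%N)
      (seg_step eta (s (epoch_end Kl j)) (iter (epoch_end Kl j))) i.
Proof.
move=> jE; have K0 : (0 < Kl j.+1)%N by apply: Kl_gt0.
rewrite /seg_hat -/(run _) {1}epoch_endS -(prednK K0) seg_run_window //.
- rewrite /rs_avg /= big_add1 /=; congr (_ *: _); apply: eq_bigr => i _.
  rewrite -[LHS]/(seg_traj _ _ _ i.+1) seg_traj_shift addn0.
  by congr seg_traj; apply/funext => i'; rewrite addnS.
- by apply: seg_run_epoch_start; exact: ltnW.
move=> i i0; rewrite prednK // => iK.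
apply: (not_restart_between jE); first by rewrite -[X in (X < _)%N]addn0 ltn_add2l.
by rewrite epoch_endS ltn_add2l.
Qed.

Lemma seg_iter_epoch j : (j < E)%N ->
  iter (epoch_end Kl j.+1) = seg_hat eta E Kl z0 s (epoch_end Kl j.+1).
Proof. by move=> jE; rewrite /iter /seg_iter epoch_end_restart. Qed.

Lemma seg_iter_tail r :
  iter (epoch_end Kl E + r)%N =
  seg_traj eta (fun i => s (epoch_end Kl E + i)%N) (iter (epoch_end Kl E)) r.
Proof.
case: r => [|r]; first by rewrite addn0.
rewrite /iter /seg_iter (negbTE (not_restart_after _)); last first.
  by rewrite -[X in (X < _)%N]addn0 ltn_add2l.
rewrite -/(run _) seg_run_window //; first exact: seg_run_epoch_start.
move=> i i0 _; apply: not_restart_after.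
by rewrite -[X in (X < _)%N]addn0 ltn_add2l.
Qed.

Lemma seg_iter0 : iter (epoch_end Kl 0) = z0.
Proof. by rewrite epoch_end0 /iter /seg_iter (negbTE not_restart0). Qed.

End restarts.

Section measurable_run.
Context {R : realType} {n m : nat} dT {T : measurableType dT}
  (xis : nat -> T -> sample R n m) (eta : R) (E : nat) (Kl : nat -> nat)
  (z0 : state R n m).

(** The length of the current epoch has to be carried along: it is
deterministic, so that the running average is a fixed multiple of the sum. *)
Lemma measurable_seg_run t :
  [/\ measurable_state (fun w : pastType xis t =>
        rs_iter (seg_run eta E Kl z0 (xis^~ w) t)),
      measurable_state (fun w : pastType xis t =>
        rs_sum (seg_run eta E Kl z0 (xis^~ w) t)) &
      exists L, forall w, rs_len (seg_run eta E Kl z0 (xis^~ w) t) = L].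
Proof.
elim: t => [|t [mi ms [L hL]]] /=.
  by split; [exact: measurable_state_cst | exact: measurable_state_cst | exists 0].
have [mi' ms' [L' hL']] : [/\ measurable_state (fun w : pastType xis t =>
        rs_iter (rs_overwrite (is_restart E Kl t)
          (seg_run eta E Kl z0 (xis^~ w) t))),
      measurable_state (fun w : pastType xis t =>
        rs_sum (rs_overwrite (is_restart E Kl t)
          (seg_run eta E Kl z0 (xis^~ w) t))) &
      exists L, forall w, rs_len (rs_overwrite (is_restart E Kl t)
          (seg_run eta E Kl z0 (xis^~ w) t)) = L].
  case: (is_restart E Kl t) => /=; last by split => //; exists L.
  split; [|exact: measurable_state_cst | by exists 0].
  rewrite /rs_avg; under eq_fun do rewrite hL.
  exact: measurable_stateZ.
have mz : measurable_state (fun w : pastType xis t.+1 =>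
    seg_step eta (xis t w) (rs_iter (rs_overwrite (is_restart E Kl t)
          (seg_run eta E Kl z0 (xis^~ w) t)))).
  apply: measurable_seg_step; first exact: past_sample_measurable.
  exact: past_stateW mi'.
split => //; last by exists L'.+1 => w; rewrite hL'.
by apply: measurable_stateD => //; exact: past_stateW ms'.
Qed.

Lemma measurable_seg_iter t :
  measurable_state (fun w : pastType xis t =>
    seg_iter eta E Kl z0 (xis^~ w) t).
Proof.
have [mi ms [L hL]] := measurable_seg_run t.
rewrite /seg_iter; case: (is_restart E Kl t) => //=.
rewrite /rs_avg; under eq_fun do rewrite hL.
exact: measurable_stateZ.
Qed.

End measurable_run.

(** * Epoch lengths *)

(** The epoch length is one less than the least integer above the positive
root of [q3 x^2 - q2 x - q1]. *)
Lemma epoch_lengthP (R : realType) (q1 q2 q3 : R) (K : nat) :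
  0 < q1 -> 0 <= q2 -> 0 < q3 ->
  K = absz (Num.ceil ((q2 + Num.sqrt (q2 ^+ 2 + 4 * q1 * q3)) / (2 * q3)) - 1) ->
  q1 + q2 * K.+1%:R <= q3 * K.+1%:R ^+ 2.
Proof.
move=> q1_gt0 q2_ge0 q3_gt0; set r := _ / _ => KE.
have disc : 0 <= q2 ^+ 2 + 4 * q1 * q3.
  by rewrite addr_ge0 ?sqr_ge0 // !mulr_ge0 // ltW.
have sqrt_gt0 : 0 < Num.sqrt (q2 ^+ 2 + 4 * q1 * q3).
  rewrite sqrtr_gt0 ltr_wpDl ?sqr_ge0 // !mulr_gt0 //.
have r0 : 0 < r by rewrite divr_gt0 ?mulr_gt0 // ltr_wpDl.
have c1 : (1 <= Num.ceil r)%R by rewrite -gtz0_ge1 ceil_gt0.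
have rK : r <= K.+1%:R.
  apply: le_trans (ceil_ge r) _.
  have -> : K.+1%:R = (K%:Z + 1)%:~R :> R by rewrite -natr1 intrD.
  by rewrite KE gez0_abs ?subr_ge0 // subrK.
have h : Num.sqrt (q2 ^+ 2 + 4 * q1 * q3) <= 2 * q3 * K.+1%:R - q2.
  by rewrite lerBrDl -ler_pdivrMl ?mulr_gt0 // mulrC.
have := lerXn2r 2 _ _ h; rewrite !nnegrE sqr_sqrtr // => /(_ _ _) h2.
have {}h2 := h2 (ltW sqrt_gt0) (le_trans (ltW sqrt_gt0) h).
rewrite -(ler_pM2l (_ : 0 < 4 * q3)); last by rewrite mulr_gt0.
by rewrite -subr_ge0; move: h2; rewrite -subr_ge0; congr (_ <= _); ring.
Qed.

(** From a block estimate [A / K^2 + C / K] to the target [q3] of the epoch.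
The hypotheses give [A] and [C] a margin of 4 / 3 below [q1] and [q2], and
[(K + 1)^2 / K^2 <= 4 / 3] as soon as [K >= 9]. *)
Lemma epoch_arith (R : realType) (K : nat) (A C r q1 q2 q3 : R) :
  (9 <= K)%N -> 0 <= A -> 0 <= C -> 4 * A <= 3 * q1 -> 4 * C <= 3 * q2 ->
  q1 + q2 * K.+1%:R <= q3 * K.+1%:R ^+ 2 ->
  r * K%:R ^+ 2 <= A + C * K%:R -> r <= q3.
Proof.
move=> K9 A0 C0 Aq Cq; rewrite -natr1.
have k9 : 9 <= K%:R :> R by rewrite ler_nat.
move: (K%:R) k9 => k k9 hq hr.
have k2 : 0 < k ^+ 2 by rewrite exprn_gt0 //; lra.
have k12 : 0 < (k + 1) ^+ 2 by rewrite exprn_gt0 //; lra.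
rewrite -(ler_pM2r k12) -(ler_pM2r k2); apply: le_trans
  (ler_wpM2r (ltW k2) hq).
rewrite mulrAC; apply: le_trans (ler_wpM2r (ltW k12) hr) _.
have kk : 3 * (k + 1) ^+ 2 <= 4 * k ^+ 2 by nra.
have k1 : 0 <= k * (k + 1) by nra.
have h1 : A * (k + 1) ^+ 2 <= q1 * k ^+ 2.
  have := ler_wpM2l A0 kk; have := ler_wpM2r (ltW k2) Aq; lra.
have h2 : C * k * (k + 1) ^+ 2 <= q2 * (k + 1) * k ^+ 2.
  have k4 : 3 * (k + 1) <= 4 * k by lra.
  have := ler_wpM2l (mulr_ge0 C0 k1) k4.
  have := ler_wpM2r (mulr_ge0 k1 (ltac:(lra) : 0 <= k)) Cq; lra.
lra.
Qed.

Lemma restart_countP (R : realType) (x : R) (E : nat) : 0 < x ->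
  E = absz (Num.max 0 (Num.ceil (2^-1 * ln x))) ->
  (forall j, (j < E)%N -> expR (2 * j%:R) <= x) /\ x <= expR (2 * E%:R).
Proof.
move=> x0 EE; have E0 : (Posz E = Num.max 0 (Num.ceil (2^-1 * ln x)))%R.
  by rewrite EE gez0_abs // le_max lexx.
split=> [j jE|].
  have : (Posz j < Num.max 0 (Num.ceil (2^-1 * ln x)))%R by rewrite -E0 ltz_nat.
  rewrite lt_max => /orP[//|]; rewrite ceil_gt_int -pmulrn => h.
  by rewrite -[leRHS](lnK (x := x)) ?posrE // ler_expR; lra.
rewrite -[leLHS](lnK (x := x)) ?posrE // ler_expR.
have : (Num.ceil (2^-1 * ln x) <= Posz E)%R by rewrite E0 le_max lexx orbT.
by rewrite ceil_le_int -pmulrn => h; lra.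
Qed.

(** * The method between two restarts *)

Section seg_bounds.
Context {R : realType} {n : nat} dS {S : measurableType dS} (Q : probability S R)
  dT {T : measurableType dT} (P : probability T R)
  (xi : S -> sample R n n) (xis : nat -> T -> sample R n n)
  (sB sB2 sg alpha : R).
Hypothesis rxi : random_element xi.
Hypothesis iid : iid_copies Q P xi xis.
Hypothesis unitB : meanB Q xi \in unitmx.
Hypothesis A1 : assumption_A1 Q xi sB sB2.
Hypothesis A2 : assumption_A2 Q xi sg.
Hypothesis alpha01 : 0 < alpha < 1.

Let B := meanB Q xi.
Let eta := eta_hat Q xi sB alpha.
Let mu := Num.min (lambda_min (meanM Q xi)) (lambda_min (meanMh Q xi)).
Let lmin := lambda_min (B *m B^T).
Let lam := (1 - alpha) * lmin.
Let s := sB ^+ 2 + eta ^+ 2 * sB2 ^+ 2.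

Let eta_gt0 : 0 < eta. Proof. exact: eta_hat_gt0 A1 unitB alpha01. Qed.
Let eta2_gt0 : 0 < eta ^+ 2. Proof. exact: exprn_gt0. Qed.
Let mu_pos : 0 < mu. Proof. exact: mu_gt0 A1. Qed.
Let s_ge0 : 0 <= s.
Proof. by apply: addr_ge0; [|apply: mulr_ge0]; exact: sqr_ge0. Qed.

Lemma lam_gt0 : 0 < lam.
Proof.
apply: mulr_gt0; last exact: lmin_gt0 A1 unitB.
by rewrite subr_gt0; case/andP: alpha01.
Qed.

Let unit_vector : exists x : 'cV[R]_n, 0 < dotv x x.
Proof.
exists (const_mx 1); rewrite dotv_gt0; apply/eqP => /matrixP.
move=> /(_ (Ordinal (size_gt0 A1)) 0).
by rewrite !mxE => /eqP; rewrite oner_eq0.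
Qed.

Lemma eta_mu_le : eta ^+ 2 * mu <= 2^-1.
Proof.
have [x x0] := unit_vector; rewrite -(ler_pM2r x0) -mulrA.
apply: le_trans (eta_hat_M A1 unitB alpha01 x).
by rewrite ler_wpM2l ?sqr_ge0 // (mu_le_M A1).
Qed.

Lemma eta_lam_le : eta ^+ 2 * lam <= 2^-1.
Proof.
have [x x0] := unit_vector; rewrite -(ler_pM2r x0) -mulrA.
apply: le_trans (eta_hat_M A1 unitB alpha01 x).
rewrite ler_wpM2l ?sqr_ge0 //; apply: le_trans (sqr_meanB_le A1 x).
apply: le_trans (lmin_le_tr Q xi x); rewrite ler_wpM2r ?dotv_ge0 //.
rewrite /lam mulrBl mul1r gerBl mulr_ge0 ?(ltW (lmin_gt0 A1 unitB)) //.
by case/andP: alpha01 => /ltW.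
Qed.

Let energy := seg_step_energy rxi A1 A2
  (eta_hat_M A1 unitB alpha01) (eta_hat_Mh A1 unitB alpha01)
  (eta_hat_M2 A1 unitB alpha01) (eta_hat_Mh2 A1 unitB alpha01)
  (mu_le_M A1) (mu_le_Mh A1).
Let deviation := seg_step_deviation rxi A1 A2
  (eta_hat_M A1 unitB alpha01) (eta_hat_Mh A1 unitB alpha01).
Let coercive z := mean_step_coercive A1 z (ltW eta_gt0) (ltW (lmax_gt0 A1))
  (lmin_le_tr Q xi) (lmin_le unitB) (lmax_ge_tr unitB) (lmax_ge Q xi)
  (eta_hat_noise A1 unitB alpha01).

Variables (t0 : nat) (Z0 : T -> state R n n) (D : R).
Hypothesis mZ0 : measurable_state (Z0 : pastType xis t0 -> state R n n).
Hypothesis EZ0 : (\int[P]_w (sqn (Z0 w))%:E <= D%:E)%E.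
Hypothesis D_ge : 3 * sg ^+ 2 / mu <= D.

Let D0 : 0 <= D.
Proof.
by apply: le_trans D_ge; rewrite divr_ge0 ?(ltW mu_pos) // mulr_ge0 ?sqr_ge0.
Qed.

Let a01 : 0 <= eta ^+ 2 * mu / 2 <= 1.
Proof.
have h := eta_mu_le; have := mulr_gt0 eta2_gt0 mu_pos.
by move: (eta ^+ 2 * mu) h => e; lra.
Qed.

Let c_ge0 : 0 <= 3 / 2 * eta ^+ 2 * sg ^+ 2.
Proof.
by do 2 (apply: mulr_ge0; last exact: sqr_ge0); rewrite divr_ge0.
Qed.

Let c_le : 3 / 2 * eta ^+ 2 * sg ^+ 2 <= eta ^+ 2 * mu / 2 * D.
Proof.
have h : 3 * sg ^+ 2 <= mu * D by rewrite [leRHS]mulrC -ler_pdivrMr.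
have -> : 3 / 2 * eta ^+ 2 * sg ^+ 2 = eta ^+ 2 / 2 * (3 * sg ^+ 2) by field.
have -> : eta ^+ 2 * mu / 2 * D = eta ^+ 2 / 2 * (mu * D) by field.
by apply: ler_wpM2l h; rewrite divr_ge0 // sqr_ge0.
Qed.

Let v_ge0 : 0 <= 2 * eta ^+ 2 * s.
Proof.
by apply: mulr_ge0; [apply: mulr_ge0; [| exact: sqr_ge0] | exact: s_ge0].
Qed.

Lemma window_energy k :
  (\int[P]_w (sqn (seg_traj eta (fun i => xis (t0 + i)%N w) (Z0 w) k))%:E
   <= D%:E)%E.
Proof.
exact: (block_energy rxi iid energy a01 c_ge0 c_le mZ0 EZ0 k).
Qed.

(** The numbers 12, 3 and 9 / 4 come from the energy of the end points and of
the deviations, weighted as in [block_sum]. *)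
Lemma window_average N : (0 < N)%N ->
  (\int[P]_w (sqn (N%:R^-1 *: \sum_(0 <= i < N)
      seg_traj eta (fun i => xis (t0 + i)%N w) (Z0 w) i)%R)%:E
   <= ((12 / lam * (D / eta ^+ 2) + (3 * s * D + 9 / 4 * sg ^+ 2) / lam * N%:R)
       / N%:R ^+ 2)%:E)%E.
Proof.
move=> N0; have Np : 0 < N%:R :> R by rewrite ltr0n.
have lam0 : 0 <= eta ^+ 2 * lam by rewrite mulr_ge0 ?sqr_ge0 ?(ltW lam_gt0).
have H := block_sum rxi iid energy deviation coercive a01 c_ge0 v_ge0 lam0
  c_le mZ0 EZ0 N.
set Z := fun w => \sum_(0 <= i < N)
  seg_traj eta (fun i => xis (t0 + i)%N w) (Z0 w) i in H *.
have mf : measurable_fun setT (fun w => (eta ^+ 2 * lam * sqn (Z w))%:E).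
  apply/measurable_EFinP; apply: (@measurable_funM _ _ _ _ (cst (eta ^+ 2 * lam))).
    exact: measurable_cst.
  apply: measurable_sqn.
  exact: (block_sum_measurable eta iid mZ0 N).
have e0 : 0 <= (eta ^+ 2 * lam * N%:R ^+ 2)^-1.
  by rewrite invr_ge0 mulr_ge0 ?sqr_ge0.
rewrite [leLHS](_ : _ = (eta ^+ 2 * lam * N%:R ^+ 2)^-1%:E *
    \int[P]_w (eta ^+ 2 * lam * sqn (Z w))%:E)%E; last first.
  rewrite -ge0_integralZl_EFin //; last first.
    by move=> w _; rewrite lee_fin mulr_ge0 ?sqn_ge0.
  apply: eq_integral => w _; rewrite -EFinM sqnZ; congr (_%:E).
  by field; rewrite !gt_eqF ?lam_gt0.
apply: (le_trans (lee_wpmul2l _ H)); first by rewrite lee_fin.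
rewrite -EFinM lee_fin le_eqVlt; apply/orP; left; apply/eqP.
by rewrite /s -/eta; field; rewrite !gt_eqF ?lam_gt0.
Qed.

End seg_bounds.

Theorem theorem3p2 (R : realType) :
  exists C : R,
  forall (n : nat)
    (dS : measure_display) (S : measurableType dS) (Q : probability S R)
    (dT : measure_display) (T : measurableType dT) (P : probability T R)
    (xi : S -> sample R n n) (xis : nat -> T -> sample R n n)
    (x0 y0 : 'cV[R]_n) (sB sB2 sg alpha : R),
  random_element xi ->
  iid_copies Q P xi xis ->
  meanB Q xi \in unitmx ->
  assumption_A1 Q xi sB sB2 ->
  assumption_A2 Q xi sg ->
  0 < sg ->
  (x0, y0) <> (0, 0) ->
  0 < alpha < 1 ->
  let B := meanB Q xi in
  let eta := eta_hat Q xi sB alpha in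
  let mu := Num.min (lambda_min (meanM Q xi)) (lambda_min (meanMh Q xi)) in
  let lam := (1 - alpha) * lambda_min (B *m B^T) in
  let D0 := enorm x0 ^+ 2 + enorm y0 ^+ 2 in
  let E := absz (Num.max 0 (Num.ceil (2^-1 * ln (mu / (3 * sg ^+ 2) * D0)))) in
  let q1 (i : nat) := 16 / lam * (expR (2 - 2 * i%:R) * D0 / eta ^+ 2) in
  let q2 (i : nat) :=
    (4 * (sB ^+ 2 + eta ^+ 2 * sB2 ^+ 2)
       * (expR (2 - 2 * i%:R) * D0 + 3 * sg ^+ 2 / mu)
     + 18 * sg ^+ 2) / lam in
  let q3 (i : nat) := D0 / expR (2 * i%:R) in
  let Kl (i : nat) :=
    absz (Num.ceil ((q2 i + Num.sqrt (q2 i ^+ 2 + 4 * q1 i * q3 i))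
                / (2 * q3 i)) - 1) in
  let hat (w : T) (K : nat) := seg_hat eta E Kl (x0, y0) (xis^~ w) K in
  let tail (w : T) (Kh : nat) := seg_tail eta E Kl (x0, y0) (xis^~ w) Kh in
  let rhs (Kh : nat) :=
    16 / lam * ((3 * sg ^+ 2 / mu) / (eta ^+ 2 * Kh.+1%:R ^+ 2))
    + (4 * (sB ^+ 2 + eta ^+ 2 * sB2 ^+ 2) * (6 * sg ^+ 2 / mu)
       + 18 * sg ^+ 2) / lam * (1 / Kh.+1%:R) in
  (forall j : nat, (1 <= j <= E)%N ->
     let K := (\sum_(1 <= i < j.+1) Kl i)%N in
     ('E_P[(fun w => enorm (hat w K).1 ^+ 2 + enorm (hat w K).2 ^+ 2)%R]
      <= (expR (- (2 * j%:R)) * (enorm x0 ^+ 2 + enorm y0 ^+ 2))%R%:E)%E)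
  /\
  (forall Kh : nat,
     ('E_P[(fun w => enorm (tail w Kh).1 ^+ 2 + enorm (tail w Kh).2 ^+ 2)%R]
      <= (rhs Kh)%:E)%E
     /\
     exists r : R,
       `|r| <= C * (eta ^+ 2 * sB ^+ 2 + eta ^+ 4 * sB2 ^+ 2)
       /\
       rhs Kh = (1 + (8 / (3 * Kh.+1%:R) + r) / (eta ^+ 2 * mu))
                * (18 * sg ^+ 2 / lam) * (1 / Kh.+1%:R)).
Proof.
exists (4 / 3) => n dS S Q dT T P xi xis x0 y0 sB sB2 sg alpha.
move=> rxi iid uB A1 A2 sg_gt0 z0_neq0 alpha01 B eta mu lam D0 E q1 q2 q3 Kl.
move=> hat tail rhs.
have eta_gt0 : 0 < eta by exact: eta_hat_gt0 A1 uB alpha01.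
have mu_pos : 0 < mu by exact: mu_gt0 A1.
have lam_pos : 0 < lam by exact: lam_gt0 uB A1 alpha01.
have eta_lam : eta ^+ 2 * lam <= 2^-1 by exact: eta_lam_le uB A1 alpha01.
have sqn_enorm (z : state R n n) :
  enorm z.1 ^+ 2 + enorm z.2 ^+ 2 = sqn z by rewrite !sqr_enorm.
have D0_gt0 : 0 < D0.
  rewrite /D0 (sqn_enorm (x0, y0)) lt_def sqn_ge0 andbT.
  rewrite paddr_eq0 ?dotv_ge0 // !dotv_eq0 /=.
  by apply/negP => /andP[/eqP x00 /eqP y00]; apply: z0_neq0; rewrite x00 y00.
pose s := sB ^+ 2 + eta ^+ 2 * sB2 ^+ 2.
have s_ge0 : 0 <= s.
  by apply: addr_ge0; [|apply: mulr_ge0]; exact: sqr_ge0.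
pose Ds := 3 * sg ^+ 2 / mu.
have Ds_gt0 : 0 < Ds by rewrite divr_gt0 // mulr_gt0 // exprn_gt0.
pose D (j : nat) := expR (- (2 * j%:R)) * D0.
have D_gt0 j : 0 < D j by rewrite mulr_gt0 ?expR_gt0.
have DS j : D j = expR 2 * D j.+1.
  by rewrite /D mulrA -expRD; congr (expR _ * _); rewrite -natr1; ring.
have expR2_ge3 : 3 <= expR 2 :> R by apply: le_trans (expR_ge1Dx 2); lra.
have q3E j : q3 j = D j by rewrite /q3 /D expRN mulrC.
have shift j : expR (2 - 2 * j.+1%:R) = expR (- (2 * j%:R)) :> R.
  by congr expR; rewrite -natr1; ring.
have q1E j : q1 j.+1 = 16 / lam * (D j / eta ^+ 2) by rewrite /q1 shift.
have q2num_ge0 j : 0 <= 4 * s * (D j + Ds) + 18 * sg ^+ 2.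
  apply: addr_ge0; last by rewrite mulr_ge0 // sqr_ge0.
  by apply: mulr_ge0; [rewrite mulr_ge0 | rewrite addr_ge0 // ltW].
have q2E j : q2 j.+1 = (4 * s * (D j + Ds) + 18 * sg ^+ 2) / lam.
  by rewrite /q2 shift.
have ratio_gt0 : 0 < mu / (3 * sg ^+ 2) * D0.
  by rewrite mulr_gt0 // divr_gt0 // mulr_gt0 // exprn_gt0.
have [E_le E_ge] := restart_countP ratio_gt0 (erefl E).
have ratioE : mu / (3 * sg ^+ 2) * D0 = D0 / Ds.
  by rewrite /Ds; field; rewrite !gt_eqF.
have Ds_le j : (j < E)%N -> Ds <= D j.
  move=> /E_le; rewrite ratioE ler_pdivlMr // /D expRN => h.
  by rewrite mulrC ler_pdivlMr ?expR_gt0 // mulrC.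
have D_le : D E <= Ds.
  move: E_ge; rewrite ratioE ler_pdivrMr // /D expRN => h.
  by rewrite mulrC ler_pdivrMr ?expR_gt0 // mulrC.
have KlP j : q1 j.+1 + q2 j.+1 * (Kl j.+1).+1%:R <=
    q3 j.+1 * (Kl j.+1).+1%:R ^+ 2.
  apply: epoch_lengthP => //.
  - by rewrite q1E mulr_gt0 ?divr_gt0 ?exprn_gt0.
  - by rewrite q2E; apply: divr_ge0; [exact: q2num_ge0 | exact: ltW].
  - by rewrite q3E.
(* The ratio of [q1] to [q3] is [16 e^2 / (eta^2 lam)], at least 96 > 9^2, so
   that the square of [Kl j.+1 + 1] exceeds 81. *)
have Kl_ge9 j : (9 <= Kl j.+1)%N.
  rewrite leqNgt; apply/negP => Kl8.
  have k9 : (Kl j.+1).+1%:R <= 9 :> R by rewrite ler_nat.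
  have k0 : 0 <= (Kl j.+1).+1%:R :> R by [].
  have q2k : 0 <= q2 j.+1 * (Kl j.+1).+1%:R.
    rewrite q2E; apply: mulr_ge0 => //.
    by apply: divr_ge0; [exact: q2num_ge0 | exact: ltW].
  have := KlP j; rewrite q3E => h.
  have k81 : D j.+1 * (Kl j.+1).+1%:R ^+ 2 <= D j.+1 * 81.
    rewrite ler_wpM2l ?(ltW (D_gt0 _)) //.
    by rewrite (_ : 81 = 9 ^+ 2) ?lerXn2r ?nnegrE //; ring.
  have q1l : q1 j.+1 * (eta ^+ 2 * lam) = 16 * (expR 2 * D j.+1).
    by rewrite q1E -DS; field; rewrite !gt_eqF.
  have q1_ge0 : 0 <= q1 j.+1.
    by rewrite q1E mulr_ge0 ?divr_ge0 ?sqr_ge0 // ltW.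
  have l1 := ler_wpM2l q1_ge0 eta_lam.
  have l2 := ler_wpM2r (ltW (D_gt0 j.+1)) expR2_ge3.
  rewrite q1l in l1; have := D_gt0 j.+1.
  move: (D j.+1) (q1 j.+1) (q2 j.+1 * _) (D j.+1 * _ ^+ 2) (expR 2 * _)
    h q2k k81 l1 l2 => d a b e f; clear; lra.
have Kl_gt0 j : (1 <= j <= E)%N -> (0 < Kl j)%N.
  by case: j => // j _; apply: leq_trans (Kl_ge9 j).
pose it j w := seg_iter eta E Kl (x0, y0) (xis^~ w) (epoch_end Kl j).
have mit j : measurable_state
    (it j : pastType xis (epoch_end Kl j) -> state R n n).
  exact: measurable_seg_iter.
(* The energy at the beginning of an epoch stays below [D j] for one step, after
   which the block over which the average is taken starts. *)
have epoch_energy j : (j <= E)%N ->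
    (\int[P]_w (sqn (it j w))%:E <= (D j)%:E)%E.
  elim: j => [|j IH] jE.
    rewrite [leLHS](_ : _ = \int[P]_w (cst D0%:E w))%E; last first.
      by apply: eq_integral => w _; rewrite /it seg_iter0 // -sqn_enorm.
    rewrite integral_cst //= probability_setT mule1 lee_fin /D mulr0 oppr0.
    by rewrite expR0 mul1r.
  have start := IH (ltnW jE).
  set t := epoch_end Kl j in start mit *.
  pose Z1 w := seg_step eta (xis t w) (it j w).
  have mZ1 : measurable_state (Z1 : pastType xis t.+1 -> state R n n).
    apply: measurable_seg_step; first exact: past_sample_measurable.
    exact: past_stateW (mit j).
  have EZ1 : (\int[P]_w (sqn (Z1 w))%:E <= (D j)%:E)%E.
    have := window_energy rxi iid uB A1 A2 alpha01 (mit j) start (Ds_le j jE) 1.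
    by apply: le_trans; rewrite /= addn0.
  have H := window_average rxi iid uB A1 A2 alpha01 mZ1 EZ1 (Ds_le j jE)
    (leq_trans (isT : (0 < 9)%N) (Kl_ge9 j)).
  rewrite [leLHS](_ : _ = \int[P]_w (sqn ((Kl j.+1)%:R^-1 *:
      \sum_(0 <= i < Kl j.+1)
        seg_traj eta (fun i => xis (t.+1 + i)%N w) (Z1 w) i)%R)%:E)%E; last first.
    by apply: eq_integral => w _; rewrite /it seg_iter_epoch // seg_hat_epoch.
  apply: (le_trans H); rewrite lee_fin -(q3E j.+1).
  apply: (@epoch_arith _ (Kl j.+1) (12 / lam * (D j / eta ^+ 2))
    ((3 * s * D j + 9 / 4 * sg ^+ 2) / lam) _ (q1 j.+1) (q2 j.+1)) => //.
  - by rewrite mulr_ge0 ?divr_ge0 ?sqr_ge0 // ltW.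
  - apply: divr_ge0; last exact: ltW.
    by rewrite addr_ge0 ?mulr_ge0 ?sqr_ge0 ?divr_ge0 // ltW.
  - rewrite q1E; have h : 0 <= D j / eta ^+ 2 / lam.
      by rewrite !divr_ge0 ?sqr_ge0 // ltW.
    by move: h; rewrite -subr_ge0 => h; rewrite -subr_ge0; lra.
  - rewrite q2E mulrA mulrA ler_pM2r ?invr_gt0 //.
    have h := mulr_ge0 s_ge0 (ltW (D_gt0 j)).
    have h' := mulr_ge0 s_ge0 (ltW Ds_gt0).
    have h'' := sqr_ge0 sg.
    by move: (sg ^+ 2) h'' h h' => e; clear; lra.
  - by rewrite divfK // sqrf_eq0 pnatr_eq0 -lt0n Kl_gt0.
split.
  case=> [|j] // jE; cbv zeta; rewrite unlock.
  under eq_integral do rewrite sqn_enorm.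
  have := epoch_energy j.+1 (proj2 (andP jE)); rewrite /D.
  apply: le_trans; rewrite le_eqVlt; apply/orP; left; apply/eqP.
  by apply: eq_integral => w _; rewrite /it seg_iter_epoch //; case/andP: jE.
move=> Kh; split.
  rewrite unlock; under eq_integral do rewrite sqn_enorm.
  have EE : (\int[P]_w (sqn (it E w))%:E <= Ds%:E)%E.
    by apply: le_trans (epoch_energy E (leqnn E)) _; rewrite lee_fin.
  have H := window_average rxi iid uB A1 A2 alpha01 (mit E) EE (lexx Ds)
    (ltn0Sn Kh).
  rewrite [leLHS](_ : _ = \int[P]_w (sqn ((Kh.+1)%:R^-1 *:
      \sum_(0 <= i < Kh.+1)
        seg_traj eta (fun i => xis (epoch_end Kl E + i)%N w) (it E w) i)%R)%:E)%E;
    last first.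
    apply: eq_integral => w _; rewrite /tail /seg_tail; congr (sqn (_ *: _))%:E.
      by apply: eq_bigr => r _; rewrite seg_iter_tail.
    by apply: eq_bigr => r _; rewrite seg_iter_tail.
  apply: (le_trans H); rewrite lee_fin /rhs -/s -/eta -/mu -/lam.
  set N := Kh.+1%:R; have N_gt0 : 0 < N :> R by rewrite ltr0n.
  rewrite -subr_ge0 (_ : _ - _ = 4 * Ds / (lam * eta ^+ 2 * N ^+ 2)
    + (5 * s * Ds + 63 / 4 * sg ^+ 2) / (lam * N)); last first.
    by rewrite /Ds; field; rewrite !gt_eqF.
  have sg2 := sqr_ge0 sg; have N2 := sqr_ge0 N; have e2 := sqr_ge0 eta.
  apply: addr_ge0; apply: divr_ge0.
  - by rewrite mulr_ge0 // ltW.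
  - by rewrite mulr_ge0 // mulr_ge0 // ltW.
  - apply: addr_ge0; last by apply: mulr_ge0 => //; rewrite divr_ge0.
    exact: (mulr_ge0 (mulr_ge0 (ler0n R 5) s_ge0) (ltW Ds_gt0)).
  - by rewrite mulr_ge0 // ltW.
exists (4 / 3 * (eta ^+ 2 * sB ^+ 2 + eta ^+ 4 * sB2 ^+ 2)); split.
  rewrite ger0_norm // mulr_ge0 ?divr_ge0 // addr_ge0 // mulr_ge0 ?sqr_ge0 //.
  by rewrite exprn_even_ge0.
rewrite /rhs; field.
by rewrite !gt_eqF ?ltr0n //.
Qed.
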